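(* Let $n\ge2$ and assume that $T=(T_1,\ldots,T_n)$ is a $\triangle^n_0$-contraction on a complex Hilbert space $H$ such that its Taylor spectrum satisfies $\sigma(T)\subset\triangle^n_0$. Then the operators $T_2,\ldots,T_n$ are invertible and $$T_j^*T_j\le T_{j+1}^*T_{j+1}\le I,\qquad j=1,\ldots,n-1.$$ In particular, $r(T_j)\le r(T_{j+1})<1$ for every $j=1,\ldots,n-1$, where $r(\cdot)$ denotes the spectral radius.
   Context: The $n$-dimensional Hartogs triangle is $\triangle^n_0=\{z\in\mathbb C^n:|z_1|<|z_2|<\cdots<|z_n|<1\}$. Consider the hereditary polynomial $$p(z,\overline w)=(1-z_n\overline w_n)\prod_{j=1}^{n-1}(z_{j+1}\overline w_{j+1}-z_j\overline w_j)=\sum_\alpha a_\alpha\overline w^\alpha z^\alpha$$ (a finite sum over $\alpha\in\mathbb Z_+^n$), which is the reciprocal of the reproducing kernel $\prod_{j=2}^n\frac1{z_j\overline w_j}\prod_{j=1}^{n-1}\big(1-\frac{z_j\overline w_j}{z_{j+1}\overline w_{j+1}}\big)^{-1}(1-z_n\overline w_n)^{-1}$ of the Hardy space of $\triangle^n_0$. A commuting $n$-tuple $T=(T_1,\ldots,T_n)$ of bounded operators on $H$ is called a $\triangle^n_0$-contraction if $\sum_\alpha a_\alpha T^{*\alpha}T^\alpha\ge0$, where $T^\alpha=T_1^{\alpha_1}\cdots T_n^{\alpha_n}$ and $T^{*\alpha}=(T^\alpha)^*$. *)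

(* Defs.v *)
From HB Require Import structures.
From mathcomp Require Import all_boot all_order all_algebra.
From mathcomp Require Import all_classical all_reals all_analysis.
From mathcomp Require Import complex.
From mathcomp Require Import (canonicals, coercions) mpoly.

Set Implicit Arguments.
Unset Strict Implicit.
Unset Printing Implicit Defensive.

Import Order.TTheory GRing.Theory Num.Theory.
Import numFieldNormedType.Exports.

Local Open Scope classical_set_scope.
Local Open Scope ring_scope.
Local Open Scope complex_scope.

(* A complex Hilbert space is a complete normed space [H] over [R[i]] together
   with an inner product [ip] (linear in its first argument, conjugate-linear
   in its second) that induces the norm of [H]. *)
Definition hilbert (R : realType) (H : completeNormedModType R[i])
    (ip : {dot H for @Num.conj R[i]}) : Prop :=
  forall x : H, `|x| ^+ 2 = ip x x.

Section Operators.
Variables (R : realType) (H : completeNormedModType R[i]).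
Variable ip : {dot H for @Num.conj R[i]}.
Implicit Types A B : H -> H.

(* For a bounded operator [A] on a Hilbert space the vector [z] exists by the
   Riesz representation theorem, and it is unique. *)
Definition adjoint A : H -> H :=
  fun y => xget 0 [set z | forall x, ip (A x) y = ip x z].

(* The order of [R[i]] makes [0 <= c] mean that [c] is real and nonnegative. *)
Definition psd A : Prop := forall x, 0 <= ip (A x) x.

Definition ople A B : Prop := psd (fun x => B x - A x).

(* [linear_bounded_continuous]: for linear maps, [bounded_near _ (nbhs 0)] is
   boundedness in the operator sense. *)
Definition invertible_op A : Prop :=
  exists S : {linear H -> H},
    [/\ bounded_near S (nbhs (0 : H)), cancel A S & cancel S A].

Definition spectrum A : set R[i] :=
  [set l | ~ invertible_op (fun x => A x - l *: x)].

Definition spectral_radius A : R := sup (@ComplexField.Normc.normc R @` spectrum A).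

End Operators.

Section Taylor.
Variables (R : realType) (H : completeNormedModType R[i]) (n : nat).

(* [xi : {ffun {set 'I_n} -> H}] stands for the element
   sum_S xi_S (x) e_S of H (x) Lambda(C^n), where e_S = e_{i1} /\ ... /\ e_{ip}
   for S = {i1 < ... < ip}.  The Koszul boundary is
   D_T = sum_j T_j (x) (e_j /\ _); for j in S, e_j /\ e_{S \ j} equals e_S up to
   the sign (-1)^#{i in S : i < j}. *)
Definition koszul (T : 'I_n -> H -> H) (xi : {ffun {set 'I_n} -> H}) :
    {ffun {set 'I_n} -> H} :=
  [ffun S : {set 'I_n} => \sum_(j in S)
     (-1) ^+ #|[set i in S | (i < j)%N]| *: T j (xi (S :\ j)%SET)].

(* D_T has degree 1, so exactness of the Koszul complex in every degree is the
   equality of the range and the kernel of D_T on the whole exterior algebra. *)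
Definition koszul_exact (T : 'I_n -> H -> H) : Prop :=
  range (koszul T) = [set xi | koszul T xi = 0].

Definition taylor_spectrum (T : 'I_n -> H -> H) : set ('I_n -> R[i]) :=
  [set l | ~ koszul_exact (fun j x => T j x - l j *: x)].

Definition oppow (T : 'I_n -> H -> H) (al : mpoly.multinom n) : H -> H :=
  \big[(fun f g => f \o g)/id]_(j < n) iter (al j) (T j).

End Taylor.

(* The coordinates z_1, ..., z_(n+1) are indexed by ['I_n.+1].  For [j : 'I_n],
   [cur j] and [nxt j] are the consecutive indices [j] and [j + 1]. *)
Definition cur (n : nat) (j : 'I_n) : 'I_n.+1 := widen_ord (leqnSn n) j.
Definition nxt (n : nat) (j : 'I_n) : 'I_n.+1 := lift ord0 j.

Definition hartogs_triangle (R : realType) (n : nat) : set ('I_n.+1 -> R[i]) :=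
  [set z | (forall j : 'I_n, `|z (cur j)| < `|z (nxt j)|) /\ `|z ord_max| < 1].

(* The polynomial P(t) = (1 - t_(n+1)) prod_j (t_(j+1) - t_j).  With wb the
   conjugate of w, p(z, wb) = P(z_1 wb_1, ..., z_(n+1) wb_(n+1)), so the
   coefficient a_al of wb^al z^al in p is the coefficient of t^al in P. *)
Definition hartogs_poly (R : realType) (n : nat) : mpoly.mpoly n.+1 R[i] :=
  (1 - mpoly.mpolyX R[i] (mpoly.mnm1 ord_max)) *
  \prod_(j < n) (mpoly.mpolyX R[i] (mpoly.mnm1 (nxt j))
                 - mpoly.mpolyX R[i] (mpoly.mnm1 (cur j))).

Lemma hartogs_polyE (R : realType) (n : nat) (z w : 'I_n.+1 -> R[i]) :
  mpoly.meval (fun j => z j * Num.conj (w j)) (hartogs_poly R n) =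
  (1 - z ord_max * Num.conj (w ord_max)) *
  \prod_(j < n) (z (nxt j) * Num.conj (w (nxt j))
                 - z (cur j) * Num.conj (w (cur j))).
Proof.
rewrite /hartogs_poly mpoly.mevalM mpoly.mevalB mpoly.meval1 mpoly.mevalXU.
congr (_ * _); rewrite rmorph_prod; apply: eq_bigr => j _ /=.
by rewrite mpoly.mevalB !mpoly.mevalXU.
Qed.

Section HartogsContraction.
Variables (R : realType) (H : completeNormedModType R[i]).
Variable ip : {dot H for @Num.conj R[i]}.

(* sum_al a_al T^{*al} T^al *)
Definition hartogs_op (n : nat) (T : 'I_n.+1 -> H -> H) : H -> H :=
  fun x => \sum_(al <- mpoly.msupp (hartogs_poly R n))
    mpoly.mcoeff al (hartogs_poly R n) *:
      adjoint ip (oppow T al) (oppow T al x).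

Definition hartogs_contraction (n : nat) (T : 'I_n.+1 -> {linear H -> H}) :
    Prop :=
  [/\ forall j, bounded_near (T j) (nbhs (0 : H)),
      forall i j x, T i (T j x) = T j (T i x)
    & psd ip (hartogs_op T)].

End HartogsContraction.

(* Main.v *)
(* Outside the Hartogs triangle the Koszul complex of T - z is exact; by open
   mapping (here: uniform boundedness) its two ends say that the column
   x |-> ((T_i - z_i) x)_i and the column of the adjoints are bounded below.
   Approximate joint eigenvalues can be extended one operator at a time, so if an
   affine combination A = c_0 + c T_i + d T_j is not bounded below, then some z with
   c_0 + c z_i + d z_j = 0 is an approximate joint eigenvalue of T, hence lies in
   the Hartogs triangle; the same holds for the adjoints, and A is invertible as
   soon as A and A^* are bounded below.  This is all that is needed of the
   spectral mapping theorem: T_(j+1) is invertible, T_(j+1) - z T_j and 1 - z T_n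
   are bounded below for |z| <= 1, and the statements on spectral radii follow.
   For the operator inequalities, a polynomial P defines the quadratic form
   h_P (x) = sum_al P_al |T^al x|^2, and multiplying P by t_i replaces x by T_i x.
   If h_((t_(j+1) - t_j) P) >= 0, then h_P does not increase along the powers of
   T_j T_(j+1)^-1, which tend to 0, so h_P >= 0; likewise for 1 - t_n.  All factors
   but one can thus be stripped from the hereditary polynomial.  The convergence
   of powers and the nonemptiness of spectra behind the extension step both
   come from an elementary form of the Gelfand formula (Rickart's argument). *)

Require Import Defs.
From HB Require Import structures.
From mathcomp Require Import all_boot all_order all_algebra.
From mathcomp Require Import all_classical all_reals all_analysis.
From mathcomp Require Import complex.
From mathcomp Require Import (canonicals, coercions) mpoly.
From mathcomp Require Import ring lra.

Set Implicit Arguments.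
Unset Strict Implicit.
Unset Printing Implicit Defensive.

Import Order.TTheory GRing.Theory Num.Theory.
Import numFieldNormedType.Exports.

Local Open Scope classical_set_scope.
Local Open Scope ring_scope.
Local Open Scope complex_scope.

(** * Norms with real values and polynomials in an operator *)

Section RealNorm.
Variables (R : realType) (V : normedModType R[i]).
Implicit Types (x y : V) (c : R[i]).

(** Norms over [R[i]] take values in [R[i]]. The real-valued copies [cmod] and [nrm] give access to
    [lra], suprema and infima. *)
Definition cmod c : R := ComplexField.Normc.normc c.
Definition nrm x : R := complex.Re `|x|.

Lemma cmodE c : `|c| = (cmod c)%:C.
Proof. by []. Qed.

Lemma nrmE x : `|x| = (nrm x)%:C.
Proof. by rewrite /nrm RRe_real // normr_real. Qed.

Lemma cmodM c d : cmod (c * d) = cmod c * cmod d.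
Proof. exact: ComplexField.Normc.normcM. Qed.

Lemma cmodX c n : cmod (c ^+ n) = cmod c ^+ n.
Proof. by apply: complexI; rewrite -cmodE normrX cmodE rmorphXn. Qed.

Lemma cmodV c : cmod c^-1 = (cmod c)^-1.
Proof. exact: ComplexField.Normc.normcV. Qed.

Lemma cmodN c : cmod (- c) = cmod c.
Proof. by apply: complexI; rewrite -!cmodE normrN. Qed.

Lemma cmod_conj c : cmod (Num.conj c) = cmod c.
Proof. by apply: complexI; rewrite -!cmodE norm_conjC. Qed.

Lemma cmod_ge0 c : 0 <= cmod c.
Proof. by rewrite -lecR -cmodE normr_ge0. Qed.

Lemma cmodD c d : cmod (c + d) <= cmod c + cmod d.
Proof. by rewrite -lecR rmorphD /= -!cmodE ler_normD. Qed.

Lemma cmod0 : cmod 0 = 0.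
Proof. by apply: complexI; rewrite -cmodE normr0. Qed.

Lemma cmod_eq0 c : (cmod c == 0) = (c == 0).
Proof. by rewrite -(inj_eq (@complexI R)) -cmodE normr_eq0. Qed.

Lemma cmod_gt0 c : (0 < cmod c) = (c != 0).
Proof. by rewrite lt_def cmod_ge0 cmod_eq0 andbT. Qed.

Lemma cmod_real (r : R) : 0 <= r -> cmod r%:C = r.
Proof. by move=> r0; apply: complexI; rewrite -cmodE ger0_norm // ler0c. Qed.

Lemma nrm_ge0 x : 0 <= nrm x.
Proof. by rewrite -lecR -nrmE normr_ge0. Qed.

Lemma nrmD x y : nrm (x + y) <= nrm x + nrm y.
Proof. by rewrite -lecR rmorphD /= -!nrmE ler_normD. Qed.

Lemma nrmN x : nrm (- x) = nrm x.
Proof. by rewrite /nrm normrN. Qed.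

Lemma nrmB x y : nrm (x - y) <= nrm x + nrm y.
Proof. by rewrite -(nrmN y) nrmD. Qed.

Lemma nrm_distC x y : nrm (x - y) = nrm (y - x).
Proof. by rewrite -nrmN opprB. Qed.

Lemma nrmZ c x : nrm (c *: x) = cmod c * nrm x.
Proof. by apply: complexI; rewrite rmorphM /= -nrmE -cmodE normrZ nrmE. Qed.

Lemma nrm0 : nrm 0 = 0.
Proof. by rewrite /nrm normr0. Qed.

Lemma nrm_eq0 x : (nrm x == 0) = (x == 0).
Proof. by rewrite -(inj_eq (@complexI R)) -nrmE normr_eq0. Qed.

Lemma nrm_gt0 x : (0 < nrm x) = (x != 0).
Proof. by rewrite lt_def nrm_ge0 nrm_eq0 andbT. Qed.

Lemma nrm_tri x y z : nrm (x - z) <= nrm (x - y) + nrm (y - z).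
Proof. by have := nrmD (x - y) (y - z); rewrite addrA subrK. Qed.

End RealNorm.

Section PolynomialAction.
Variables (K : nzRingType) (V : lmodType K) (S : {linear V -> V}).

(** This is [p(S) x]. Identities between commuting expressions in [S] become polynomial identities,
    which [ring] can prove. *)
Definition pact (p : {poly K}) (x : V) : V := \sum_(i < size p) p`_i *: iter i S x.

Lemma pactE n (p : {poly K}) (x : V) : (size p <= n)%N ->
  pact p x = \sum_(i < n) p`_i *: iter i S x.
Proof.
move=> pn; rewrite /pact (big_ord_widen _ (fun i => p`_i *: iter i S x) pn).
rewrite big_mkcond; apply: eq_bigr => i _.
by case: ltnP => // ?; rewrite nth_default // scale0r.
Qed.

Lemma pactD p q (x : V) : pact (p + q) x = pact p x + pact q x.
Proof.
have [sp sq spq] : [/\ size p <= maxn (size p) (size q),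
  size q <= maxn (size p) (size q) &
  size (p + q)%R <= maxn (size p) (size q)]%N.
  by rewrite leq_maxl leq_maxr size_polyD.
rewrite (pactE _ sp) (pactE _ sq) (pactE _ spq) -big_split.
by apply: eq_bigr => i _; rewrite coefD scalerDl.
Qed.

Lemma pactCM c p (x : V) : pact (c%:P * p) x = c *: pact p x.
Proof.
rewrite (@pactE (size p)) ?/pact; last by rewrite mul_polyC size_scale_leq.
by rewrite scaler_sumr; apply: eq_bigr => i _; rewrite coefCM scalerA.
Qed.

Lemma pactN p (x : V) : pact (- p) x = - pact p x.
Proof. by rewrite -mulN1r -polyCN pactCM scaleN1r. Qed.

Lemma pactB p q (x : V) : pact (p - q) x = pact p x - pact q x.
Proof. by rewrite pactD pactN. Qed.

Lemma pactC c (x : V) : pact c%:P x = c *: x.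
Proof.
rewrite (@pactE 1) ?size_polyC_leq1 // big_ord_recl big_ord0 coefC /=.
by rewrite addr0.
Qed.

Lemma pact0 (x : V) : pact 0 x = 0.
Proof. by rewrite -polyC0 pactC scale0r. Qed.

Lemma pact1 (x : V) : pact 1 x = x.
Proof. by rewrite -polyC1 pactC scale1r. Qed.

Lemma iter_linearD n : {morph iter n S : x y / x + y}.
Proof. by elim: n => [|n IH] x y //=; rewrite IH linearD. Qed.

Lemma iter_linearZ n c (x : V) : iter n S (c *: x) = c *: iter n S x.
Proof. by elim: n => //= n ->; rewrite linearZ. Qed.

Lemma iter_linearB n (x y : V) : iter n S (x - y) = iter n S x - iter n S y.
Proof. by rewrite iter_linearD -scaleN1r iter_linearZ scaleN1r. Qed.

Lemma iter_linear0 n : iter n S 0 = 0.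
Proof. by rewrite -(subrr 0) iter_linearB !subrr. Qed.

Lemma pactXn n (x : V) : pact 'X^n x = iter n S x.
Proof.
rewrite (@pactE n.+1) ?size_polyXn // (bigD1 ord_max) //= coefXn eqxx scale1r.
rewrite big1 ?addr0 // => i /negPf ni.
by rewrite coefXn -[_ == n]/(i == ord_max) ni scale0r.
Qed.

Lemma pactMX p (x : V) : pact (p * 'X) x = pact p (S x).
Proof.
rewrite (@pactE (size p).+1); last first.
  have [->|p0] := eqVneq p 0; first by rewrite mul0r size_poly0.
  by rewrite size_mulX.
rewrite big_ord_recl coefMX eqxx scale0r add0r; apply: eq_bigr => i _.
by rewrite coefMX lift0 -iterSr.
Qed.

Lemma pact_linearD p : {morph pact p : x y / x + y}.
Proof.
move=> x y; rewrite -big_split; apply: eq_bigr => i _.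
by rewrite iter_linearD scalerDr.
Qed.

Lemma pact_linear0 p : pact p 0 = 0.
Proof. by rewrite /pact big1 // => i _; rewrite iter_linear0 scaler0. Qed.

Lemma pactMC p c (x : V) : pact (p * c%:P) x = pact p (c *: x).
Proof.
elim/poly_ind: p => [|p d IH] in x *; first by rewrite mul0r !pact0.
rewrite mulrDl -mulrA -commr_polyX mulrA !pactD !pactMX IH linearZ.
by rewrite -polyCM !pactC scalerA.
Qed.

Lemma pactM p q (x : V) : pact (p * q) x = pact p (pact q x).
Proof.
elim/poly_ind: q p x => [|q c IH] p x; first by rewrite mulr0 !pact0 pact_linear0.
by rewrite mulrDr !pactD pactMC pactC mulrA pactMX IH pactMX pact_linearD.
Qed.

End PolynomialAction.

(** * Powers and resolvents *)

Section PowerLemma.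
Variables (R : realType) (V : normedModType R[i]) (S : {linear V -> V}).
Variables (q : V -> R) (M : R).
Hypothesis q_ge0 : forall x, 0 <= q x.
Hypothesis qD : forall x y, q (x + y) <= q x + q y.
Hypothesis qZ : forall c x, q (c *: x) = cmod c * q x.
Hypothesis M_ge0 : 0 <= M.
Hypothesis nrmS : forall x, nrm (S x) <= M * nrm x.
Hypothesis qS : forall x, q (S x) <= M * q x.

Lemma q_iter n x : q (iter n S x) <= M ^+ n * q x.
Proof.
elim: n => [|n IH]; first by rewrite expr0 mul1r.
by rewrite iterS (le_trans (qS _)) // exprS -mulrA ler_wpM2l.
Qed.

Lemma nrm_iter n x : nrm (iter n S x) <= M ^+ n * nrm x.
Proof.
elim: n => [|n IH]; first by rewrite expr0 mul1r.
by rewrite iterS (le_trans (nrmS _)) // exprS -mulrA ler_wpM2l.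
Qed.

Lemma q0 : q 0 = 0.
Proof. by rewrite -[X in q X](scale0r 0) qZ cmod0 mul0r. Qed.

Lemma q_sum (n : nat) (F : 'I_n -> V) : q (\sum_(i < n) F i) <= \sum_(i < n) q (F i).
Proof.
elim/big_ind2 : _ => [|x a y b xa yb|//]; first by rewrite q0.
exact: le_trans (qD _ _) (lerD xa yb).
Qed.

(** Errors in [q] are only tracked up to a constant: every estimate below holds modulo some
    [e * q u]. For [q = 0] it concerns the norm alone, in general it concerns vectors on which [q]
    is negligible. *)
Lemma q_pact p : exists2 e, 0 <= e & forall x, q (pact S p x) <= e * q x.
Proof.
exists (\sum_(i < size p) cmod p`_i * M ^+ i) => [|x].
  by apply: sumr_ge0 => i _; rewrite mulr_ge0 ?cmod_ge0 ?exprn_ge0.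
rewrite (le_trans (q_sum _)) // mulr_suml; apply: ler_sum => i _.
by rewrite qZ -mulrA ler_wpM2l ?cmod_ge0 ?q_iter.
Qed.

Variables (C Z : R).
Hypothesis C_ge0 : 0 <= C.
Hypothesis Z_ge0 : 0 <= Z.
Hypothesis resolvent : forall z, cmod z <= Z -> forall x,
  nrm x <= C * (nrm (x - z *: S x) + q x).

(** The quotient [res_diff / res_den] is formally [(1 - (z S)^n)^-1 - (1 - (w S)^n)^-1]. To avoid
    inverses, numerator and denominator are applied to the same vector and compared. *)
Let res_diff n (z w : R[i]) : {poly R[i]} := (z ^+ n - w ^+ n)%:P * 'X^n.
Let res_den n (z w : R[i]) : {poly R[i]} :=
  (1 - (z ^+ n)%:P * 'X^n) * (1 - (w ^+ n)%:P * 'X^n).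

(* [1 / (1 - b^2) = (1 / (1 - b) + 1 / (1 + b)) / 2], and [- z^n = (r z)^n] for
   a root [r] of [-1], hence the Lipschitz constant of [z |-> (1 - (z S)^n)^-1]
   does not deteriorate when [n] is doubled. *)
Lemma power_lipschitz m (n := (2 ^ m)%N) z w : cmod z <= Z -> cmod w <= Z ->
  exists2 e, 0 <= e & forall u,
    nrm (pact S (res_diff n z w) u) <=
    M * C ^+ 2 * cmod (z - w) * nrm (pact S (res_den n z w) u) + e * q u.
Proof.
rewrite {}/n; elim: m z w => [|m IH] z w zZ wZ.
  (* Base case: the resolvent bound is used at [w] on [u] and at [z] on [v = u - w S u], and [e]
     controls [q v]. *)
  have [e e0 qe] := q_pact (1 - w%:P * 'X).
  exists (cmod (z - w) * M * (C ^+ 2 * e + C)).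
    by rewrite !mulr_ge0 ?addr_ge0 ?mulr_ge0 ?exprn_ge0 ?cmod_ge0.
  move=> u; rewrite /res_diff /res_den expn0 !expr1.
  rewrite pactCM -['X]expr1 pactXn /= nrmZ.
  have den x y : pact S (1 - x%:P * 'X^1) y = y - x *: S y.
    by rewrite pactB pact1 pactCM pactXn.
  have qe' := qe u; rewrite -['X]expr1 den in qe'.
  rewrite pactM !den; set v := u - _ in qe' *.
  have r1 := resolvent wZ u; have r2 := resolvent zZ v.
  have := nrmS u; have := cmod_ge0 (z - w); have := q_ge0 u.
  rewrite -/v in r1; set a := nrm (v - _) in r2 *; set c := cmod _.
  move=> q0 c0 Su.
  have vle : nrm v <= C * (a + e * q u) by rewrite (le_trans r2) // ler_wpM2l // lerD2l.
  have ule : nrm u <= C * (C * (a + e * q u) + q u).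
    by rewrite (le_trans r1) // ler_wpM2l // lerD2r.
  have Sle : nrm (S u) <= M * (C * (C * (a + e * q u) + q u)).
    by rewrite (le_trans Su) // ler_wpM2l.
  have := ler_wpM2l c0 Sle; lra.
have [r rN] : exists r : R[i], r ^+ (2 ^ m) = -1.
  elim: m {IH} => [|m [r rN]]; first by exists (-1); rewrite expr1.
  by exists (sqrtC r); rewrite expnS exprM sqrtCK.
have r1 : cmod r = 1.
  apply/eqP; rewrite -(@pexpr_eq1 _ _ (2 ^ m)) ?cmod_ge0 ?expn_gt0 // -cmodX rN.
  by rewrite cmodN -[1]/(1%:C) cmod_real.
have rZ x : cmod x <= Z -> cmod (r * x) <= Z by rewrite cmodM r1 mul1r.
have [e1 e10 h1] := IH _ _ zZ wZ.
have [e2 e20 h2] := IH _ _ (rZ _ zZ) (rZ _ wZ).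
have crr : cmod (r * z - r * w) = cmod (z - w) by rewrite -mulrBr cmodM r1 mul1r.
(* With [a = (z S)^(2^m)] and [b = (w S)^(2^m)], the factors [pp = (1 + a)(1 + b)] and
   [pm = (1 - a)(1 - b)] bring the quotients at [z, w] and at [r z, r w] to the common denominator
   [(1 - a^2)(1 - b^2)]; half the sum of the numerators is [a^2 - b^2]. *)
pose pp := (1 + (z ^+ (2 ^ m))%:P * 'X^(2 ^ m)) * (1 + (w ^+ (2 ^ m))%:P * 'X^(2 ^ m)).
pose pm := (1 - (z ^+ (2 ^ m))%:P * 'X^(2 ^ m)) * (1 - (w ^+ (2 ^ m))%:P * 'X^(2 ^ m)).
have [f1 f10 g1] := q_pact pp.
have [f2 f20 g2] := q_pact pm.
exists (e1 * f1 + e2 * f2); first by rewrite addr_ge0 ?mulr_ge0.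
move=> u.
have P1 : res_den (2 ^ m) z w * pp = res_den (2 ^ m.+1) z w.
  by rewrite /res_den /pp !expnS !(mulnC 2) !exprM !polyC_exp; ring.
have P2 : res_den (2 ^ m) (r * z) (r * w) * pm = res_den (2 ^ m.+1) z w.
  rewrite /res_den /pm !exprMn rN !mulN1r !polyCN !expnS !(mulnC 2) !exprM.
  by rewrite !polyC_exp; ring.
have P3 : res_diff (2 ^ m.+1) z w = (2^-1)%:P * (res_diff (2 ^ m) z w * pp +
   res_diff (2 ^ m) (r * z) (r * w) * pm).
  rewrite /res_diff /pp /pm !exprMn rN !mulN1r !expnS !(mulnC 2) !exprM.
  rewrite !polyCB !polyCN !polyC_exp.
  set a := z%:P ^+ _; set b := w%:P ^+ _; set y := 'X^_.
  have -> : (a - b) * y * ((1 + a * y) * (1 + b * y)) +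
     (- a - - b) * y * ((1 - a * y) * (1 - b * y)) =
     2%:R%:P * ((a ^+ 2 - b ^+ 2) * y ^+ 2).
    by rewrite (_ : 2%:R%:P = 2%:R); [ring|rewrite polyC_natr].
  by rewrite [RHS]mulrA -polyCM mulVf ?pnatr_eq0 // mul1r.
have g1' := h1 (pact S pp u); rewrite -pactM -pactM P1 in g1'.
have g2' := h2 (pact S pm u); rewrite -pactM -pactM P2 crr in g2'.
move: g1' g2'; rewrite P3 pactCM nrmZ pactD.
have -> : cmod 2^-1 = 2^-1 :> R.
  by rewrite cmodV -[2]/(2%:R) -(rmorph_nat (real_complex R)) cmod_real.
have := nrmD (pact S (res_diff (2 ^ m) z w * pp) u)
  (pact S (res_diff (2 ^ m) (r * z) (r * w) * pm) u).
have := ler_wpM2l e10 (g1 u); have := ler_wpM2l e20 (g2 u).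
have := q_ge0 u; have := mulr_ge0 e10 f10; have := mulr_ge0 e20 f20.
move: (q u) (M * _ * _) => Q L h0 h0' Q0 ? ? ? ? ?.
have := mulr_ge0 h0 Q0; have := mulr_ge0 h0' Q0; lra.
Qed.

Let small n r := exists2 e, 0 <= e &
  forall u, r ^+ n * nrm (iter n S u) <= nrm u / 4%:R + e * q u.

Let lipschitz_power n := forall z w, cmod z <= Z -> cmod w <= Z ->
  exists2 e, 0 <= e & forall u,
    nrm (pact S (res_diff n z w) u) <=
    M * C ^+ 2 * cmod (z - w) * nrm (pact S (res_den n z w) u) + e * q u.

(* With [B = (r S)^n] small, [(1 - (s S)^n)^-1] stays within a fixed distance of
   [(1 - B)^-1], hence of [1], as long as [s - r] is small, uniformly in [n]. *)
Lemma small_extend n r s : lipschitz_power n -> 0 <= r -> r <= s -> s <= Z ->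
  M * C ^+ 2 * (s - r) <= 4%:R^-1 -> small n r ->
  exists2 e, 0 <= e & forall u, s ^+ n * nrm (iter n S u) <= nrm u + e * q u.
Proof.
move=> lipn r0 rs sZ srK [e e0 he].
have s0 := le_trans r0 rs.
have [||e' e'0 he'] := lipn r%:C s%:C.
- by rewrite cmod_real // (le_trans rs).
- by rewrite cmod_real.
have [f f0 qf] := q_pact (1 - (s%:C ^+ n)%:P * 'X^n).
(* The estimates below bound [11/16] of the left-hand side by
   [9/16 * nrm u + (e + e f / 4 + e') * q u], and [16/11 <= 2]. *)
exists (2 * (e + e * f + e')) => [|u]; first by rewrite !(addr_ge0, mulr_ge0).
have linE (t : R) y : pact S (1 - (t%:C ^+ n)%:P * 'X^n) y =
    y - (t ^+ n)%:C *: iter n S y.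
  by rewrite pactB pact1 pactCM pactXn rmorphXn.
have [v vE v'E] : exists2 v, v = pact S (1 - (s%:C ^+ n)%:P * 'X^n) u &
    v = u - (s ^+ n)%:C *: iter n S u.
  by eexists; [reflexivity | exact: linE].
have qv : q v <= f * q u by rewrite vE.
have nZ (t : R) y : 0 <= t -> nrm (y - (t ^+ n)%:C *: iter n S y) <=
    nrm y + t ^+ n * nrm (iter n S y).
  move=> t0; apply: (le_trans (nrmB _ _)); rewrite nrmZ cmod_real //.
  exact: exprn_ge0.
have nv : nrm v <= nrm u + s ^+ n * nrm (iter n S u) by rewrite v'E; exact: nZ.
have den : nrm (pact S (res_den n r%:C s%:C) u) <= nrm v + r ^+ n * nrm (iter n S v).
  apply: le_trans (nZ r v r0); by rewrite -(linE r v) vE -pactM.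
have dsr : cmod (r%:C ^+ n - s%:C ^+ n) = s ^+ n - r ^+ n.
  by rewrite -cmodN opprB -!rmorphXn -rmorphB cmod_real // subr_ge0 lerXn2r.
have csr : cmod (r%:C - s%:C) = s - r.
  by rewrite -cmodN opprB -rmorphB cmod_real // subr_ge0.
have h := he' u; rewrite /res_diff pactCM pactXn nrmZ dsr csr in h.
have hu := he u; have hv := he v.
have sr0 : 0 <= s - r by rewrite subr_ge0.
have K0 : 0 <= M * C ^+ 2 * (s - r) by rewrite !mulr_ge0 ?exprn_ge0.
move: {vE v'E he he' dsr csr} (M * C ^+ 2 * _) (nrm (pact _ _ _)) den K0 srK h.
move=> K D den K0 srK h.
have D0 : 0 <= nrm v + r ^+ n * nrm (iter n S v).
  by rewrite addr_ge0 ?mulr_ge0 ?exprn_ge0 ?nrm_ge0.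
have h1 := ler_wpM2l K0 den; have h2 := ler_wpM2r D0 srK.
have h3 := ler_wpM2l e0 qv; have u0 := nrm_ge0 u; have q0 := q_ge0 u.
have := mulr_ge0 e0 q0; have := mulr_ge0 e'0 q0; have := mulr_ge0 (mulr_ge0 e0 f0) q0.
lra.
Qed.

(** Induction along [[0, Z']] in steps of [d / 2]. Smallness at [r1] gives the bound [1] at
    [s = r1 + d] by [small_extend]; going back from [s] to [r <= th * s] gains the factor
    [th ^ (2 ^ m) <= 1/4]. One [m] serves all steps because [d] does not depend on the exponent. *)
Lemma power_small_lt Z' : 0 <= Z' -> Z' < Z -> exists2 n, (0 < n)%N & small n Z'.
Proof.
move=> Z'0 Z'Z.
have Z0 : 0 < Z by apply: le_lt_trans Z'Z.
pose K := M * C ^+ 2 + 1.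
have K0 : 0 < K by rewrite ltr_wpDl // mulr_ge0 ?exprn_ge0.
pose d := Num.min (Z - Z') (4 * K)^-1.
have d0 : 0 < d by rewrite lt_min subr_gt0 Z'Z invr_gt0 mulr_gt0.
(* As [s <= Z], multiplication by [th] moves [s] back by at most [d / 2], hence not below
   [r1 + d / 2 >= r]. *)
pose th := 1 - d / (2 * Z).
have dZ : d <= Z by rewrite (@le_trans _ _ (Z - Z')) ?ge_min ?lexx // gerBl.
have th01 : 0 <= th < 1.
  have : 0 < d / (2 * Z) by rewrite divr_gt0 ?mulr_gt0.
  have : d / (2 * Z) <= 2^-1 by rewrite ler_pdivrMr ?mulr_gt0 // mulrA mulVf ?mul1r.
  by rewrite /th; lra.
have [m thm] : exists m, th ^+ (2 ^ m) <= 4^-1.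
  have : `|th| < 1 by case/andP: th01 => ? ?; rewrite ger0_norm.
  move=> /cvg_expr /cvgrPdist_lt /(_ 4^-1); case=> [|N _ hN]; first by rewrite invr_gt0.
  exists N; have := hN (2 ^ N)%N (ltnW (ltn_expl _ _)) => /(_ isT).
  have th0 : 0 <= th by case/andP: th01.
  by rewrite sub0r normrN ger0_norm ?exprn_ge0 // => /ltW.
exists (2 ^ m)%N; first by rewrite expn_gt0.
have step i : forall r, 0 <= r -> r <= Z' -> r <= i%:R * (d / 2) -> small (2 ^ m) r.
  elim: i => [|i IH] r r0 rZ'.
    rewrite mul0r => r0'; have -> : r = 0 by apply/le_anti/andP.
    exists 0 => // u; rewrite expr0n expn_eq0 /= !mul0r addr0.
    by rewrite divr_ge0 ?nrm_ge0.
  move=> ri; pose r1 := Num.max 0 (r - d / 2); pose s := r1 + d.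
  have r10 : 0 <= r1 by rewrite le_max lexx.
  have r1Z : r1 <= Z' by rewrite ge_max Z'0; lra.
  have sZ : s <= Z.
    have : d <= Z - Z' by rewrite ge_min lexx.
    rewrite /s; lra.
  have [e e0 he] : exists2 e, 0 <= e & forall u,
      s ^+ (2 ^ m) * nrm (iter (2 ^ m) S u) <= nrm u + e * q u.
    apply: (@small_extend _ r1 s) => //; [exact: power_lipschitz|by rewrite lerDl ltW| |].
      rewrite /s addrAC subrr add0r; apply: (@le_trans _ _ (K * d)).
        by rewrite ler_wpM2r ?(ltW d0) // lerDl.
      have : d <= (4 * K)^-1 by rewrite ge_min lexx orbT.
      rewrite -(ler_pM2l K0) => /le_trans; apply.
      by rewrite invfM mulrCA mulfV ?gt_eqF // mulr1.
    apply: IH => //; rewrite ge_max mulr_ge0 ?divr_ge0 ?(ltW d0) //=.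
    by move: ri; rewrite -natr1; lra.
  have rs : r <= th * s.
    have s0 : 0 <= s by rewrite addr_ge0 // ltW.
    have -> : th * s = s - d / 2 * (s / Z).
      by rewrite /th; field; rewrite gt_eqF.
    have : s / Z <= 1 by rewrite ler_pdivrMr // mul1r.
    have : r - d / 2 <= r1 by rewrite le_max lexx orbT.
    have d2 : 0 <= d / 2 by rewrite divr_ge0 // ltW.
    move=> rr1 /(ler_wpM2l d2); rewrite /s; lra.
  exists (e / 4) => [|u]; first by rewrite divr_ge0.
  have : r ^+ (2 ^ m) <= (th * s) ^+ (2 ^ m).
    have th0 : 0 <= th by case/andP: th01.
    have s0 : 0 <= s by rewrite addr_ge0 // ltW.
    by rewrite lerXn2r ?nnegrE // mulr_ge0.
  move=> /(ler_wpM2r (nrm_ge0 (iter (2 ^ m) S u))) /le_trans; apply.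
  rewrite exprMn -[leLHS]mulrA.
  apply: (@le_trans _ _ (4^-1 * (s ^+ (2 ^ m) * nrm (iter (2 ^ m) S u)))).
    by rewrite ler_wpM2r // mulr_ge0 ?exprn_ge0 ?nrm_ge0 ?addr_ge0 // ltW.
  have := he u; lra.
have [i Zi] : exists i : nat, Z' / (d / 2) <= i%:R.
  exists (Num.truncn (Z' / (d / 2))).+1; apply/ltW; exact: truncnS_gt.
apply: (step i) => //; by rewrite -ler_pdivrMr ?divr_gt0.
Qed.

End PowerLemma.

(** Near-covering compactness of the square [[-Z, Z]^2], with the filter of large constants. A point
    of the square outside the disc has a ball that misses the disc, so the claim is vacuous
    there. *)
Lemma disc_compactness (R : realType) (Z : R) (P : R -> R[i] -> Prop) :
  (forall C D z, C <= D -> P C z -> P D z) ->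
  (forall z, cmod z <= Z -> exists2 d, 0 < d &
     exists C, forall w, cmod (w - z) < d -> P C w) ->
  exists C, forall z, cmod z <= Z -> P C z.
Proof.
move=> mono loc.
pose K : set (R * R) := `[- Z, Z]%classic `*` `[- Z, Z]%classic.
have /compact_near_coveringP cK : compact K.
  by apply: compact_setX; exact: segment_compact.
pose Q C (p : R * R) := cmod (p.1 +i* p.2) <= Z -> P C (p.1 +i* p.2).
have dist (p p' : R * R) : cmod ((p'.1 +i* p'.2) - (p.1 +i* p.2)) <=
    `|p.1 - p'.1| + `|p.2 - p'.2|.
  have -> : (p'.1 +i* p'.2) - (p.1 +i* p.2) =
      (p'.1 - p.1)%:C + 'i%C * (p'.2 - p.2)%:C.
    by simpc.
  rewrite (le_trans (cmodD _ _)) // cmodM.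
  have real_cmod (r : R) : cmod r%:C = `|r|.
    by rewrite /cmod /= expr0n addr0 sqrtr_sqr.
  rewrite !real_cmod (distrC p.1) (distrC p.2) lerD2l.
  by rewrite /cmod /= expr0n add0r expr1n sqrtr1 mul1r.
have [C [_ QC]] : \forall C \near +oo, K `<=` Q C.
  apply: cK => p _.
  have [d d0 [C hC]] : exists2 d, 0 < d & exists C, forall p' : R * R,
      cmod ((p'.1 +i* p'.2) - (p.1 +i* p.2)) < d -> Q C p'.
    case: (leP (cmod (p.1 +i* p.2)) Z) => [pZ|Zp].
      by have [d d0 [C hC]] := loc _ pZ; exists d => //; exists C => p' /hC + _.
    exists (cmod (p.1 +i* p.2) - Z); first by rewrite subr_gt0.
    exists 0 => p' pd p'Z.
    have := cmodD ((p.1 +i* p.2) - (p'.1 +i* p'.2)) (p'.1 +i* p'.2).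
    rewrite subrK -(cmodN (_ - _)) opprB; lra.
  have d2 : 0 < d / 2 by rewrite divr_gt0.
  exists (ball p (d / 2), [set D | C < D]).
    split; first exact: nbhsx_ballx.
    by exists C; split => //; rewrite num_real.
  move=> [p' D] [] /= [/= b1 b2] CD pZ; apply: (mono C _ _ (ltW CD)).
  apply: hC => //.
  by rewrite (le_lt_trans (dist _ _)) // (splitr d) ltrD.
exists (C + 1) => -[a b] zZ; apply: (QC (C + 1) _ (a, b)) => //.
  by rewrite ltrDl.
have ha : `|a| <= Z.
  apply: le_trans zZ; rewrite -lecR -cmodE; exact: (normc_ge_Re (a +i* b)).
have hb : `|b| <= Z.
  apply: le_trans zZ; rewrite /cmod /= -sqrtr_sqr ler_sqrt ?addr_ge0 ?sqr_ge0 //.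
  by rewrite lerDr sqr_ge0.
by split; rewrite /= in_itv /= -ler_norml.
Qed.

(** * Uniform resolvent bounds and extension of approximate eigenvalues *)

Section Resolvent.
Variables (R : realType) (V : normedModType R[i]) (S : {linear V -> V}).
Variables (q : V -> R) (M : R).
Hypothesis q_ge0 : forall x, 0 <= q x.
Hypothesis qD : forall x y, q (x + y) <= q x + q y.
Hypothesis qZ : forall c x, q (c *: x) = cmod c * q x.
Hypothesis M_gt0 : 0 < M.
Hypothesis nrmS : forall x, nrm (S x) <= M * nrm x.
Hypothesis qS : forall x, q (S x) <= M * q x.

Let bounds z C := forall x, nrm x <= C * (nrm (x - z *: S x) + q x).

Lemma bounds_mono z C D : C <= D -> bounds z C -> bounds z D.
Proof.
move=> CD h x; apply: le_trans (h x) _.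
by rewrite ler_wpM2r // addr_ge0 ?nrm_ge0.
Qed.

(** The two operators differ on [x] by at most [nrm x / (2 * C)], so half of [nrm x] can be
    absorbed. *)
Lemma bounds_perturb z w C : 0 < C -> 2 * C * M * cmod (w - z) <= 1 ->
  bounds z C -> bounds w (2 * C).
Proof.
move=> C0 zw h x; have := h x.
have : nrm (x - z *: S x) <= nrm (x - w *: S x) + cmod (w - z) * (M * nrm x).
  have -> : x - z *: S x = (x - w *: S x) + (w - z) *: S x.
    by rewrite scalerBl addrA subrK.
  by rewrite (le_trans (nrmD _ _)) // lerD2l nrmZ ler_wpM2l ?cmod_ge0.
move=> /(ler_wpM2l (ltW C0)).
have := ler_wpM2r (nrm_ge0 x) zw.
by move: (nrm x) (nrm _) (nrm _) (q x) (cmod _) => *; lra.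
Qed.

(** Compactness makes the constant uniform on the disc, and a uniform constant survives on a
    slightly larger one. This strict gain in radius feeds [power_small_lt], and later yields a
    spectral gap. *)
Lemma uniform_resolvent Z : 0 <= Z ->
  (forall z, cmod z <= Z -> exists C, bounds z C) ->
  exists2 Z1, Z < Z1 & exists2 C, 0 < C & forall z, cmod z <= Z1 -> bounds z C.
Proof.
move=> Z0 h.
have [C hC] : exists C, forall z, cmod z <= Z -> bounds z C.
  apply: disc_compactness => [C D z|z /h[C hC]]; first exact: bounds_mono.
  have C1 : 0 < Num.max C 1 by rewrite lt_max ltr01 orbT.
  have C2 : 0 < 2 * Num.max C 1 * M by rewrite !mulr_gt0.
  exists (2 * Num.max C 1 * M)^-1; first by rewrite invr_gt0.
  exists (2 * Num.max C 1) => w wz; apply: (@bounds_perturb z) => //.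
    by rewrite -ler_pdivlMl // mulr1 ltW.
  by apply: bounds_mono hC; rewrite le_max lexx.
have {}hC : forall z, cmod z <= Z -> bounds z (Num.max C 1).
  by move=> z /hC; apply: bounds_mono; rewrite le_max lexx.
have C1 : 0 < Num.max C 1 by rewrite lt_max ltr01 orbT.
move: (Num.max C 1) C1 hC => {}C C0 hC.
pose d := (2 * C * M)^-1.
have d0 : 0 < d by rewrite invr_gt0 !mulr_gt0.
exists (Z + d); first by rewrite ltrDl.
exists (2 * C); first by rewrite mulr_gt0.
(* Scaling by [t] maps the disc of radius [Z + d] into that of radius [Z] and moves each point by at
   most [d]. *)
move=> z zZ; pose t := Z / (Z + d).
have Zd : 0 < Z + d by rewrite ltr_wpDl.
have t0 : 0 <= t by rewrite divr_ge0 // ltW.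
have t1 : 0 <= 1 - t by rewrite subr_ge0 ler_pdivrMr // mul1r lerDl ltW.
apply: (@bounds_perturb (t%:C * z)) => //; last first.
  by apply: hC; rewrite cmodM cmod_real // mulrAC ler_pdivrMr // ler_wpM2l.
have -> : z - t%:C * z = (1 - t)%:C * z by rewrite rmorphB rmorph1 mulrBl mul1r.
rewrite cmodM cmod_real //.
rewrite -ler_pdivlMl ?mulr_gt0 // mulr1 -/d.
apply: le_trans (ler_wpM2l t1 zZ) _.
by rewrite /t mulrBl mul1r divfK ?gt_eqF // addrAC subrr add0r.
Qed.

Lemma power_small Z : 0 <= Z ->
  (forall z, cmod z <= Z -> exists C, bounds z C) ->
  exists2 n, (0 < n)%N & exists2 e, 0 <= e &
  forall u, Z ^+ n * nrm (iter n S u) <= nrm u / 4%:R + e * q u.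
Proof.
move=> Z0 /(uniform_resolvent Z0)[Z1 ZZ1 [C C0 hC]].
apply: (@power_small_lt _ _ _ _ M _ _ _ _ _ _ C Z1) => //; apply: ltW => //.
Qed.

(* Otherwise [S] would act on the approximate kernel of [q] with every [S - z]
   bounded below, in particular invertible for large [z], hence for all [z]:
   this contradicts Liouville's theorem. *)
Lemma approximate_point_extension :
  (forall z, exists C, forall x, nrm x <= C * (nrm (S x - z *: x) + q x)) ->
  exists C, forall x, nrm x <= C * q x.
Proof.
move=> h; have [C0 hC0] := h 0.
pose C := Num.max C0 1.
have C1 : 1 <= C by rewrite le_max lexx orbT.
have Cgt0 : 0 < C by apply: lt_le_trans C1.
have hC x : nrm x <= C * (nrm (S x) + q x).
  have := hC0 x; rewrite scale0r subr0 => /le_trans; apply.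
  by rewrite ler_wpM2r ?addr_ge0 ?nrm_ge0 // le_max lexx.
have iterC n : exists2 e, 0 <= e & forall x, nrm x <= C ^+ n * nrm (iter n S x) + e * q x.
  elim: n => [|n [e e0 IH]]; first by exists 0 => // x; rewrite mul1r mul0r addr0.
  exists (e + C ^+ n * C * M ^+ n).
    by rewrite addr_ge0 // !mulr_ge0 ?exprn_ge0 // ltW.
  move=> x; apply: le_trans (IH x) _.
  have Cn : 0 <= C ^+ n by rewrite exprn_ge0 // ltW.
  have := ler_wpM2l Cn (hC (iter n S x)).
  have := @q_iter _ _ S q M (ltW M_gt0) qS n x.
  move=> /(ler_wpM2l (mulr_ge0 Cn (ltW Cgt0))); rewrite iterS exprSr; lra.
(* At radius [C] the two bounds collide: [iterC] gives [nrm x <= C^n * nrm (S^n x)] modulo [q],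
   while [power_small] bounds the right side by [nrm x / 4] modulo [q]. The operators [1 - z S] are
   controlled at every [z]: for [z = 0] trivially, otherwise as multiples of [S - z^-1]. *)
have [] := @power_small C (ltW Cgt0).
  move=> z _; have [->|z0] := eqVneq z 0.
    exists 1 => x; rewrite scale0r subr0 mul1r lerDl //.
  have [D hD] := h z^-1.
  have D1 : 0 <= Num.max D 0 by rewrite le_max lexx orbT.
  pose D' := Num.max D 0 * (1 + (cmod z)^-1).
  have zi0 : 0 < (cmod z)^-1 by rewrite invr_gt0 cmod_gt0.
  exists D' => x; apply: le_trans (hD x) _.
  have -> : nrm (S x - z^-1 *: x) = (cmod z)^-1 * nrm (x - z *: S x).
    rewrite -cmodV -nrmZ scalerBr scalerA mulVf // scale1r nrm_distC //.
  have a0 := nrm_ge0 (x - z *: S x); have q0 := q_ge0 x.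
  apply: (@le_trans _ _ (Num.max D 0 * ((cmod z)^-1 * nrm (x - z *: S x) + q x))).
    rewrite ler_wpM2r ?le_max ?lexx // addr_ge0 // mulr_ge0 // ltW //.
  rewrite /D' -mulrA ler_wpM2l //.
  have := mulr_ge0 (ltW zi0) q0; lra.
move=> n n0 [e e0 he]; have [f f0 hf] := iterC n.
exists (2 * (e + f)) => x.
have := he x; have := hf x; have := nrm_ge0 x.
have := mulr_ge0 e0 (q_ge0 x); have := mulr_ge0 f0 (q_ge0 x); lra.
Qed.

End Resolvent.

(** * Joint approximate point spectrum *)

Section Operators.
Variables (R : realType) (V : normedModType R[i]).
Implicit Types A B : V -> V.

Definition op_bounded A := exists2 M, 0 < M & forall x, nrm (A x) <= M * nrm x.

Definition bounded_below A := exists C, forall x, nrm x <= C * nrm (A x).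

Lemma op_boundedP (A : {linear V -> V}) :
  bounded_near A (nbhs (0 : V)) <-> op_bounded A.
Proof.
rewrite linear_boundedP; split=> [/pinfty_ex_gt0[r r0 hr]|[M M0 hM]].
  have rr : r = (complex.Re r)%:C by rewrite RRe_real // ger0_real // ltW.
  exists (complex.Re r); first by rewrite -ltcR -rr.
  by move=> x; have := hr x; rewrite !nrmE rr -rmorphM lecR.
exists M%:C; split; first by rewrite complex_real.
move=> c Mc x; apply: (@le_trans _ _ (M%:C * `|x|)).
  by rewrite !nrmE -rmorphM lecR.
by rewrite ler_wpM2r // ltW.
Qed.

Definition shift_op (A : {linear V -> V}) (c : R[i]) : {linear V -> V} :=
  A \- c \*: idfun.

Lemma shift_opE (A : {linear V -> V}) c x : shift_op A c x = A x - c *: x.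
Proof. by []. Qed.

Definition lincomb_op (A B : {linear V -> V}) (a b : R[i]) : {linear V -> V} :=
  a \*: A \+ b \*: B.

Lemma lincomb_opE (A B : {linear V -> V}) a b x :
  lincomb_op A B a b x = a *: A x + b *: B x.
Proof. by []. Qed.

Lemma op_bounded_lincomb (A B : {linear V -> V}) a b :
  op_bounded A -> op_bounded B -> op_bounded (lincomb_op A B a b).
Proof.
move=> [M M0 hM] [N N0 hN]; exists (cmod a * M + cmod b * N + 1).
  by rewrite ltr_wpDl // addr_ge0 // mulr_ge0 ?cmod_ge0 // ltW.
move=> x; rewrite lincomb_opE (le_trans (nrmD _ _)) // !nrmZ.
have := ler_wpM2l (cmod_ge0 a) (hM x); have := ler_wpM2l (cmod_ge0 b) (hN x).
have := nrm_ge0 x; lra.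
Qed.

Lemma op_bounded_id : op_bounded (idfun : V -> V).
Proof. by exists 1 => // x; rewrite mul1r. Qed.

Lemma op_bounded_shift (A : {linear V -> V}) c :
  op_bounded A -> op_bounded (shift_op A c).
Proof.
move=> hA; have [M M0 hM] := op_bounded_lincomb 1 (- c) hA op_bounded_id.
by exists M => // x; have := hM x; rewrite lincomb_opE scale1r scaleNr.
Qed.

Section Joint.
Variables (n : nat) (T : 'I_n -> {linear V -> V}) (A : {linear V -> V}).
Hypothesis bT : forall i, op_bounded (T i).
Hypothesis TT : forall i j x, T i (T j x) = T j (T i x).
Hypothesis TA : forall i x, A (T i x) = T i (A x).

Definition defect (z : 'I_n -> R[i]) (x : V) : R := \sum_i nrm (T i x - z i *: x).

Lemma defect_ge0 z x : 0 <= defect z x.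
Proof. by apply: sumr_ge0 => i _; exact: nrm_ge0. Qed.

(** The coordinates are removed one at a time by [approximate_point_extension], applied to [T i]
    with [q] the sum of the remaining defects and [nrm (A x)]. Commutativity makes [T i] bounded for
    [q]. *)
Lemma joint_bounded_below :
  (forall z, exists C, forall x, nrm x <= C * (defect z x + nrm (A x))) ->
  bounded_below A.
Proof.
pose q s (z : 'I_n -> R[i]) x : R := \sum_(i <- s) nrm (T i x - z i *: x) + nrm (A x).
have q_ge0 s z x : 0 <= q s z x.
  by rewrite addr_ge0 ?nrm_ge0 // sumr_ge0 // => i _; exact: nrm_ge0.
have qD s z x y : q s z (x + y) <= q s z x + q s z y.
  rewrite /q addrACA -big_split linearD lerD ?nrmD // ler_sum // => i _.
  by rewrite linearD scalerDr opprD addrACA nrmD.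
have qZ s z c x : q s z (c *: x) = cmod c * q s z x.
  rewrite /q linearZ nrmZ mulrDr mulr_sumr; congr (_ + _); apply: eq_bigr => i _.
  by rewrite linearZ scalerA mulrC -scalerA -scalerBr nrmZ.
suff main s : uniq s ->
    (forall z, exists C, forall x, nrm x <= C * q s z x) -> bounded_below A.
  move=> h; apply: (main (index_enum 'I_n)); first exact: index_enum_uniq.
  exact: h.
elim: s => [_ /(_ (fun=> 0))[C hC]|i s IH /= /andP[nis us] h].
  by exists C => x; have := hC x; rewrite /q big_nil add0r.
apply: IH => // z; have [M M0 hM] := bT i.
apply: (approximate_point_extension (q_ge0 s z) (@qD s z) (@qZ s z) M0 hM) => [x|m].
  rewrite /q mulrDr mulr_sumr lerD //; last by rewrite TA.
  by apply: ler_sum => j _; rewrite TT -linearZ -linearB.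
(* The value [m] is inserted at the coordinate [i]; since [i] is not in [s], the other defects are
   unchanged. *)
have [C hC] := h (fun j => if j == i then m else z j); exists C => x.
apply: le_trans (hC x) _; rewrite /q big_cons eqxx -addrA.
rewrite (eq_big_seq (fun j => nrm (T j x - z j *: x))) //.
by move=> j js; case: eqP => // ji; rewrite -ji js in nis.
Qed.

(** At an approximate joint eigenvalue [z], [A] acts approximately as the scalar [a z]. Where [a z]
    is nonzero, a small defect and a small [A x] already force [x] to be small, so only the zeros of
    [a] remain. *)
Lemma bounded_below_of_symbol (a : ('I_n -> R[i]) -> R[i]) :
  (forall z, exists M, forall x, nrm (A x - a z *: x) <= M * defect z x) ->
  (forall z, a z = 0 -> exists C, forall x, nrm x <= C * defect z x) ->
  bounded_below A.
Proof.
move=> ha h; apply: joint_bounded_below => z.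
have [az|az] := eqVneq (a z) 0.
  have [C hC] := h z az; exists (Num.max C 0) => x; apply: le_trans (hC x) _.
  rewrite (@le_trans _ _ (Num.max C 0 * defect z x)) //.
    by rewrite ler_wpM2r ?defect_ge0 // le_max lexx.
  by rewrite ler_wpM2l ?lerDl ?nrm_ge0 // le_max lexx orbT.
have [M hM] := ha z.
have a0 : 0 < cmod (a z) by rewrite cmod_gt0.
exists ((cmod (a z))^-1 * Num.max M 1) => x.
rewrite -mulrA ler_pdivlMl // -nrmZ.
apply: (@le_trans _ _ (nrm (A x - a z *: x) + nrm (A x))).
  by rewrite -[X in nrm X <= _](subKr (A x)) (le_trans (nrmB _ _)) // addrC.
rewrite mulrDr lerD //.
  by rewrite (le_trans (hM x)) // ler_wpM2r ?defect_ge0 // le_max lexx.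
by rewrite ler_peMl ?nrm_ge0 // le_max lexx orbT.
Qed.

End Joint.
End Operators.

(** * Uniform boundedness *)

Section UniformBoundedness.
Variables (R : realType) (V : lmodType R[i]).
Implicit Types p f : V -> R.

Definition seminorm p := [/\ forall x, 0 <= p x,
  forall x y, p (x + y) <= p x + p y & forall c x, p (c *: x) = cmod c * p x].

(** The seminorm is a parameter because uniform boundedness is applied both to the norm of [H] and
    to [sum_i nrm (T i x)]. *)
Definition complete_for p := forall s : nat -> V,
  (forall e, 0 < e -> exists N, forall m k, (N <= m)%N -> (N <= k)%N ->
     p (s m - s k) <= e) ->
  exists x, forall e, 0 < e -> exists N, forall m, (N <= m)%N -> p (s m - x) <= e.

Lemma seminormN p x : seminorm p -> p (- x) = p x.
Proof.
move=> [_ _ pZ]; rewrite -scaleN1r pZ cmodN -(rmorph1 (real_complex R)).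
by rewrite cmod_real // mul1r.
Qed.

(** [N] is the supremum of [f] over the unit ball of [p]; as it need not be attained, the factor
    [2/3] leaves room for a near-maximizer, which is then rescaled to size [t]. *)
Lemma seminorm_near_optimal p f B : seminorm p -> seminorm f ->
  (forall x, f x <= B * p x) ->
  exists N, (forall x, f x <= N * p x) /\
    forall t, 0 < t -> exists2 y, p y <= t & (2 / 3) * N * t <= f y.
Proof.
move=> [p0 pD pZ] [f0 fD fZ] fB.
pose E := [set f y | y in [set y | p y <= 1]].
have f00 : f 0 = 0 by rewrite -(scale0r 0) fZ cmod0 mul0r.
have p00 : p 0 = 0 by rewrite -(scale0r 0) pZ cmod0 mul0r.
have E0 : E 0 by exists 0; rewrite //= p00.
have B0 : 0 <= Num.max B 0 by rewrite le_max lexx orbT.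
have supE : has_sup E.
  split; first by exists 0.
  exists (Num.max B 0) => _ [y /= py <-].
  apply: le_trans (fB y) _; apply: (@le_trans _ _ (Num.max B 0 * p y)).
    by rewrite ler_wpM2r // le_max lexx.
  by rewrite -[leRHS]mulr1 ler_wpM2l.
exists (sup E); split=> [x|t t0].
  have [px|px] := eqVneq (p x) 0.
    by have := fB x; rewrite px !mulr0.
  have px0 : 0 < p x by rewrite lt_def px p0.
  rewrite -ler_pdivrMr //.
  have -> : f x / p x = f ((p x)^-1%:C *: x).
    by rewrite fZ cmod_real ?invr_ge0 // mulrC.
  apply: ub_le_sup; first by case: supE.
  by exists ((p x)^-1%:C *: x); rewrite //= pZ cmod_real ?invr_ge0 // mulVf.
have sE : 0 <= sup E by apply: ub_le_sup => //; case: supE.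
have [y py hy] : exists2 y, p y <= 1 & (2 / 3) * sup E <= f y.
  have [sE0|sE0] := eqVneq (sup E) 0.
    by exists 0; rewrite ?p00 ?sE0 ?mulr0 ?f0.
  have sEp : 0 < sup E / 3 by rewrite divr_gt0 // lt_def sE0.
  have [_ [y py <-] hy] := sup_adherent sEp supE.
  by exists y => //; move: hy => /=; lra.
exists (t%:C *: y); first by rewrite pZ cmod_real ?(ltW t0) // ler_piMr // ltW.
by rewrite fZ cmod_real ?(ltW t0) // mulrC ler_wpM2l // ltW.
Qed.

(* Sokal's gliding hump: [f (x + y)] or [f (x - y)] is at least [f y]. *)
Lemma uniform_boundedness p (I : Type) (f : I -> V -> R) :
  seminorm p -> complete_for p -> (forall i, seminorm (f i)) ->
  (forall i, exists B, forall x, f i x <= B * p x) ->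
  (forall x, exists B, forall i, f i x <= B) ->
  exists B, forall i x, f i x <= B * p x.
Proof.
move=> sp cp sf fp fx; apply: contrapT => unb.
have [p0 pD pZ] := sp.
have p00 : p 0 = 0 by rewrite -(scale0r 0) pZ cmod0 mul0r.
(* After the step [k] the remaining steps sum to at most [3/2 * t k.+1 = t k / 2]. Of the hump
   [2/3 * N k * t k] at least [(2/3 - 1/2) * N k * t k] survives in the limit, and
   [N k * t k >= 6 * k.+1] makes this at least [k.+1]. *)
pose t k : R := 3^-1 ^+ k.
have t0 k : 0 < t k by rewrite exprn_gt0 ?invr_gt0.
have tS k : t k.+1 = t k / 3 by rewrite /t exprSr.
have step k : exists iNy : I * R * V, let: (i, N, y) := iNy in
    [/\ forall x, f i x <= N * p x, 6 * k.+1%:R <= N * t k, p y <= t k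
      & (2 / 3) * N * t k <= f i y].
  have [i hi] : exists i, ~ forall x, f i x <= 6 * k.+1%:R / t k * p x.
    apply: contrapT => /forallNP h; apply: unb; exists (6 * k.+1%:R / t k) => i.
    exact: contrapT (h i).
  have [B hB] := fp i.
  have [N [hN opt]] := seminorm_near_optimal sp (sf i) hB.
  have [y py hy] := opt _ (t0 k).
  exists (i, N, y); split => //; rewrite leNgt; apply/negP => Nlt; apply: hi => x.
  apply: le_trans (hN x) _; rewrite ler_wpM2r //.
  by rewrite ler_pdivlMr // ltW.
have [c hc] := choice step.
pose g k := f (c k).1.1; pose N k := (c k).1.2; pose y k := (c k).2.
have {}hc k : [/\ forall x, g k x <= N k * p x, 6 * k.+1%:R <= N k * t k, p (y k) <= t k
      & (2 / 3) * N k * t k <= g k (y k)].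
  by have := hc k; rewrite /g /N /y; case: (c k) => [[]].
pose s := fix s k := if k is k'.+1 then
  (if g k' (y k') <= g k' (s k' + y k') then s k' + y k' else s k' - y k') else 0.
have sg k : seminorm (g k) by exact: sf.
have hs k : p (s k.+1 - s k) <= t k /\ g k (y k) <= g k (s k.+1).
  have [_ _ pv _] := hc k; have [_ gD gZ] := sg k.
  rewrite /=; case: ifPn => [|]; first by rewrite addrAC subrr add0r.
  rewrite -ltNge => lt; rewrite addrAC subrr add0r seminormN //; split=> //.
  have := gD (s k + y k) (- (s k - y k)).
  have -> : s k + y k - (s k - y k) = 2%:R *: y k.
    by rewrite opprB addrC addrA subrK scaler_nat mulr2n.
  rewrite seminormN // gZ -(rmorph_nat (real_complex R)) cmod_real //.
  move: lt => /=; lra.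
have tail k m : p (s (k + m)%N - s k) <= 3 / 2 * (t k - t (k + m)%N).
  elim: m => [|m IH]; first by rewrite addn0 !subrr p00 mulr0.
  have := pD (s (k + m).+1 - s (k + m)%N) (s (k + m)%N - s k).
  rewrite addrA subrK addnS tS; have [+ _] := hs (k + m)%N; lra.
have tail' k m : (k <= m)%N -> p (s m - s k) <= 3 / 2 * t k.
  by move=> km; have := tail k (m - k)%N; rewrite subnKC //; have := t0 m; lra.
have tlim e : 0 < e -> exists k, 3 / 2 * t k <= e.
  move=> e0; have : `|3^-1 : R| < 1 by rewrite ger0_norm ?invr_ge0 // invf_lt1 // ltr1n.
  move=> /cvg_expr /cvgrPdist_lt /(_ (e / 2)); case=> [|k _ hk]; first exact: divr_gt0.
  exists k; have := hk k (leqnn k); rewrite sub0r normrN ger0_norm ?(ltW (t0 k)) //.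
  by rewrite -/(t k); lra.
have [|x hx] := cp s.
  move=> e e0; have [k hk] := tlim (e / 2) (divr_gt0 e0 (ltr0n _ 2)).
  exists k => m l km kl.
  have := pD (s m - s k) (- (s l - s k)).
  rewrite opprB addrA subrK -(opprB (s l) (s k)) seminormN //.
  have := tail' k m km; have := tail' k l kl; lra.
have hxk k : p (s k.+1 - x) <= t k / 2.
  apply/ler_addgt0Pr => e e0; have [m hm] := hx e e0.
  have := pD (s k.+1 - s (maxn m k.+1)) (s (maxn m k.+1) - x).
  rewrite addrA subrK -(opprB (s (maxn _ _)) (s k.+1)) seminormN //.
  have := tail' k.+1 _ (leq_maxr m k.+1); have := hm _ (leq_maxl m k.+1).
  rewrite tS; lra.
have [B hB] := fx x.
pose k := Num.truncn B.
have Bk : B < k.+1%:R by exact: truncnS_gt.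
have [_ h4] := hs k; have [h1 h2 _ h3] := hc k.
have [_ gD _] := sg k.
have := gD (s k.+1 - x) x; rewrite subrK.
have N0 : 0 <= N k.
  have : 0 <= N k * t k by apply: le_trans h2; rewrite mulr_ge0.
  by rewrite pmulr_lge0.
have := h1 (s k.+1 - x); have := ler_wpM2l N0 (hxk k).
have : g k x <= B by exact: hB.
move: h2 h3 h4 Bk; move: (s k.+1) => sk.
move: (g k (sk - x)) (g k sk) (g k (y k)) (g k x) (p (sk - x)) (k.+1%:R) (N k) (t k).
move=> *; lra.
Qed.

End UniformBoundedness.

(** * Hilbert spaces and adjoints *)

Section HilbertSpace.
Variables (R : realType) (H : completeNormedModType R[i]).
Variable ip : {dot H for @Num.conj R[i]}.
Hypothesis hip : hilbert ip.
Implicit Types x y z : H.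

Lemma nrm_complete : complete_for (@nrm R H).
Proof.
move=> s cs.
have : cvg (s @ \oo).
  apply/cauchy_cvgP/cauchy_exP => e e0.
  have e'0 : 0 < complex.Re e by move: e0; rewrite ltcE => /andP[].
  have eE : e = (complex.Re e)%:C by rewrite RRe_real // gtr0_real.
  have [N hN] := cs (complex.Re e / 2) (divr_gt0 e'0 (ltr0n _ 2)).
  exists (s N); exists N => // m /= Nm; rewrite -ball_normE /ball_ /= nrmE eE ltcR.
  apply: le_lt_trans (hN N m (leqnn N) Nm) _.
  by rewrite ltr_pdivrMr // ltr_pMr // ltr1n.
move=> /cvg_ex[x /cvgrPdist_le sx]; exists x => e e0.
have [|N _ hN] := sx e%:C; first by rewrite ltcR.
by exists N => m Nm; have := hN m Nm; rewrite /= nrmE lecR nrm_distC.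
Qed.

Definition rip x y : R := complex.Re (ip x y).

Lemma ipC x y : ip x y = Num.conj (ip y x).
Proof. by rewrite hermC expr0 mul1r. Qed.

Lemma ipDl x y z : ip (x + y) z = ip x z + ip y z.
Proof. exact: linearDl. Qed.

Lemma ipDr x y z : ip x (y + z) = ip x y + ip x z.
Proof. by rewrite ipC ipDl rmorphD /= -!ipC. Qed.

Lemma ipZl c x y : ip (c *: x) y = c * ip x y.
Proof. exact: linearZl_LR. Qed.

Lemma ipZr c x y : ip x (c *: y) = Num.conj c * ip x y.
Proof. by rewrite ipC ipZl rmorphM /= -ipC. Qed.

Lemma ip0l x : ip 0 x = 0. Proof. by rewrite -(scale0r 0) ipZl mul0r. Qed.
Lemma ip0r x : ip x 0 = 0. Proof. by rewrite ipC ip0l rmorph0. Qed.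

Lemma ipNl x y : ip (- x) y = - ip x y.
Proof. by rewrite -scaleN1r ipZl mulN1r. Qed.

Lemma ipNr x y : ip x (- y) = - ip x y.
Proof. by rewrite ipC ipNl rmorphN /= -ipC. Qed.

Lemma ipBl x y z : ip (x - y) z = ip x z - ip y z.
Proof. by rewrite ipDl ipNl. Qed.

Lemma ipBr x y z : ip x (y - z) = ip x y - ip x z.
Proof. by rewrite ipDr ipNr. Qed.

Lemma ip_suml (I : Type) (s : seq I) (P : pred I) (F : I -> H) y :
  ip (\sum_(i <- s | P i) F i) y = \sum_(i <- s | P i) ip (F i) y.
Proof. by elim/big_rec2: _ => [|i a b _ <-]; rewrite ?ip0l ?ipDl. Qed.

Lemma ip_sumr (I : Type) (s : seq I) (P : pred I) (F : I -> H) y :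
  ip y (\sum_(i <- s | P i) F i) = \sum_(i <- s | P i) ip y (F i).
Proof. by elim/big_rec2: _ => [|i a b _ <-]; rewrite ?ip0r ?ipDr. Qed.

Lemma ip_nrm x : ip x x = (nrm x ^+ 2)%:C.
Proof. by rewrite -hip nrmE rmorphXn. Qed.

Lemma ripC x y : rip x y = rip y x.
Proof. by rewrite /rip ipC; case: (ip y x). Qed.

Lemma nrmD2 x y : nrm (x + y) ^+ 2 = nrm x ^+ 2 + nrm y ^+ 2 + 2 * rip x y.
Proof.
have : rip (x + y) (x + y) = rip x x + rip y y + (rip x y + rip y x).
  by rewrite /rip ipDl !ipDr !raddfD /=; lra.
by rewrite (ripC y) /rip !ip_nrm /=; lra.
Qed.

Lemma conj_real (r : R) : Num.conj r%:C = r%:C :> R[i].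
Proof. exact: conjc_real. Qed.

Lemma ripZr (t : R) x y : rip x (t%:C *: y) = t * rip x y.
Proof. by rewrite /rip ipZr; case: (ip x y) => a b /=; simpc. Qed.

Lemma ripNr x y : rip x (- y) = - rip x y.
Proof. by rewrite /rip ipNr raddfN. Qed.

Lemma nrmZr (t : R) x : nrm (t%:C *: x) ^+ 2 = t ^+ 2 * nrm x ^+ 2.
Proof. by rewrite nrmZ exprMn /cmod /= expr0n addr0 sqr_sqrtr ?sqr_ge0. Qed.

Lemma parallelogram x y :
  nrm (x + y) ^+ 2 + nrm (x - y) ^+ 2 = 2 * nrm x ^+ 2 + 2 * nrm y ^+ 2.
Proof. by rewrite !nrmD2 nrmN ripNr; lra. Qed.

(** Cauchy-Schwarz, from the square of the norm of [nrm y *: x - nrm x *: y]. The version [ip_le]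
    for the modulus follows by rotating [x]. *)
Lemma rip_le x y : rip x y <= nrm x * nrm y.
Proof.
have [->|x0] := eqVneq x 0; first by rewrite /rip ip0l nrm0 mul0r.
have [->|y0] := eqVneq y 0; first by rewrite /rip ip0r nrm0 mulr0.
have nx : 0 < nrm x by rewrite nrm_gt0.
have ny : 0 < nrm y by rewrite nrm_gt0.
have := sqr_ge0 (nrm ((nrm y)%:C *: x - (nrm x)%:C *: y)).
rewrite nrmD2 nrmN !nrmZr ripNr ripZr (ripC _ y) ripZr (ripC y).
move=> h; have : 0 <= 2 * (nrm x * nrm y) * (nrm x * nrm y - rip x y) by lra.
by rewrite pmulr_rge0 ?mulr_gt0 // subr_ge0.
Qed.

Lemma ip_le x y : cmod (ip x y) <= nrm x * nrm y.
Proof.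
have [->|i0] := eqVneq (ip x y) 0; first by rewrite cmod0 mulr_ge0 ?nrm_ge0.
have c0 : 0 < cmod (ip x y) by rewrite cmod_gt0.
pose c := (cmod (ip x y))%:C / ip x y.
have c1 : cmod c = 1 by rewrite cmodM cmod_real ?cmod_ge0 // cmodV mulfV ?gt_eqF.
have := rip_le (c *: x) y; rewrite nrmZ c1 mul1r; apply: le_trans.
by rewrite /rip ipZl /c mulfVK.
Qed.

Lemma ip_ext x y : (forall z, ip z x = ip z y) -> x = y.
Proof.
move=> h; apply/eqP; rewrite -subr_eq0 -nrm_eq0 -sqrf_eq0.
by apply/eqP/complexI; rewrite -ip_nrm ipBr h subrr.
Qed.

(** [W] need not be closed. A minimizing sequence is Cauchy by the parallelogram law, and its limit
    [m] is a nearest point to [x] in the closure of [W]. *)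
Lemma projection (W : H -> Prop) x : W 0 ->
  (forall u v, W u -> W v -> W (u + v)) -> (forall c u, W u -> W (c *: u)) ->
  exists2 m, (forall e, 0 < e -> exists2 w, W w & nrm (w - m) <= e) &
    forall w, W w -> ip (x - m) w = 0.
Proof.
move=> W0 WD WZ; pose E := [set nrm (x - w) | w in W].
have E0 : E !=set0 by exists (nrm (x - 0)); exists 0.
have infE : has_inf E.
  by split => //; exists 0 => _ [w _ <-]; exact: nrm_ge0.
pose d := inf E.
have dle w : W w -> d <= nrm (x - w).
  by move=> Ww; apply: ge_inf; [case: infE | exists w].
have d0 : 0 <= d by apply: lb_le_inf => // _ [w _ <-]; exact: nrm_ge0.
have near_inf k : exists w, W w /\ nrm (x - w) <= d + k.+1%:R^-1.
  have [|_ [w Ww <-] hw] := @inf_adherent _ E k.+1%:R^-1 _ infE.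
    by rewrite invr_gt0.
  by exists w; split => //; exact: ltW.
have [s hs] := choice near_inf.
have inv_small (e : R) : 0 < e -> exists N : nat, forall k, (N <= k)%N -> k.+1%:R^-1 <= e.
  move=> e0; exists (Num.truncn e^-1) => k Nk.
  rewrite invf_ple ?posrE // ltW // (lt_le_trans (truncnS_gt _)) //.
  by rewrite ler_nat.
have [m hm] : exists m, forall e, 0 < e ->
    exists N, forall k, (N <= k)%N -> nrm (s k - m) <= e.
  apply: nrm_complete => e e0.
  (* For [f <= 1] one has [4 (d + f)^2 - 4 d^2 <= (8 d + 4) f], which is at most [e^2] for this
     choice. *)
  have f0 : 0 < Num.min 1 (e ^+ 2 / (8 * d + 4)).
    by rewrite lt_min ltr01 divr_gt0 ?exprn_gt0 // ltr_wpDl // mulr_ge0.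
  have [N hN] := inv_small _ f0; exists N => k l Nk Nl.
  rewrite -(@ler_pXn2r _ 2) ?nnegrE ?nrm_ge0 ?(ltW e0) //.
  have [Wk hk] := hs k; have [Wl hl] := hs l.
  have := parallelogram (x - s l) (x - s k).
  have -> : x - s l - (x - s k) = s k - s l.
    by rewrite opprB addrC addrA subrK.
  have -> : x - s l + (x - s k) = 2%:R *: (x - 2^-1 *: (s l + s k)).
    rewrite scalerBr scalerA mulfV ?pnatr_eq0 // scale1r scaler_nat mulr2n.
    by rewrite addrACA opprD.
  have Wkl : W (2^-1 *: (s l + s k)) by apply: WZ; exact: WD.
  have := dle _ Wkl; move: (x - _ *: _) => v dv.
  rewrite nrmZ -(rmorph_nat (real_complex R)) cmod_real //.
  have := hN k Nk; have := hN l Nl.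
  move: (k.+1%:R^-1) (l.+1%:R^-1) hk hl => a b hk hl la lb.
  move: f0 la lb; set f := Num.min _ _ => f0 la lb.
  have f1 : f <= 1 by rewrite ge_min lexx.
  have fe : f * (8 * d + 4) <= e ^+ 2.
    by rewrite -ler_pdivlMr ?ge_min ?lexx ?orbT // ltr_wpDl // mulr_ge0.
  have h1 : nrm (x - s k) ^+ 2 <= (d + f) ^+ 2.
    rewrite lerXn2r ?nnegrE ?nrm_ge0 ?addr_ge0 ?(ltW f0) //; lra.
  have h2 : nrm (x - s l) ^+ 2 <= (d + f) ^+ 2.
    rewrite lerXn2r ?nnegrE ?nrm_ge0 ?addr_ge0 ?(ltW f0) //; lra.
  have h3 : d ^+ 2 <= nrm v ^+ 2 by rewrite lerXn2r ?nnegrE ?nrm_ge0.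
  have h4 : f ^+ 2 <= f by rewrite expr2 ler_piMr // ltW.
  rewrite exprMn; nra.
have approx e : 0 < e -> exists2 w, W w & nrm (w - m) <= e.
  by move=> /hm[N hN]; exists (s N); [have [] := hs N | exact: hN].
exists m => // w Ww.
have xm : nrm (x - m) <= d.
  apply/ler_addgt0Pr => e e0; have e2 : 0 < e / 2 by rewrite divr_gt0.
  have [N hN] := hm _ e2; have [N' hN'] := inv_small _ e2.
  have [_ h1] := hs (maxn N N').
  have := nrm_tri x (s (maxn N N')) m.
  have := hN _ (leq_maxl N N'); have := hN' _ (leq_maxr N N').
  move: h1; move: (_.+1%:R^-1) => a; lra.
have mins u : W u -> nrm (x - m) <= nrm (x - m - u).
  move=> Wu; apply: le_trans xm _; apply/ler_addgt0Pr => e e0.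
  have [v Wv hv] := approx e e0; have := dle _ (WD _ _ Wv Wu).
  have := nrmD (x - m - u) (m - v).
  by rewrite nrm_distC in hv; rewrite addrAC addrA subrK -addrA -opprD; lra.
move: (x - m) mins {xm} => v mins.
have orth u : W u -> rip v u = 0.
  move=> Wu; set r := rip v u; set b := nrm u ^+ 2.
  have b0 : 0 <= b by rewrite sqr_ge0.
  (* The exact minimizer would be [r / b]; adding [1] avoids the division by zero and still gives
     [t^2 (b + 2) <= 0]. *)
  pose t := r / (b + 1).
  have := mins (t%:C *: u) (WZ _ _ Wu).
  rewrite -(@ler_pXn2r _ 2) ?nnegrE ?nrm_ge0 // nrmD2 nrmN ripNr ripZr nrmZr.
  rewrite -/r -/b.
  have b1 : 0 < b + 1 by rewrite ltr_wpDl.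
  have rt : r = t * (b + 1) by rewrite /t divfK // gt_eqF.
  rewrite rt => h.
  have : t ^+ 2 * (b + 2) <= 0 by lra.
  rewrite pmulr_lle0; last by lra.
  move=> h2; have /eqP : t ^+ 2 = 0 by apply/le_anti; rewrite h2 sqr_ge0.
  by rewrite sqrf_eq0 => /eqP ->; rewrite mul0r.
(* Testing with [w] kills the real part, with ['i *: w] the imaginary part. *)
have o1 := orth w Ww; have o2 := orth _ (WZ 'i%C w Ww).
move: o1 o2; rewrite /rip ipZr; case: (ip v w) => a b /= ->.
by simpc => /= ->.
Qed.

(** Let [v] be the component orthogonal to the kernel of a vector on which [f] is [1]. Then
    [x - f x *: v] is in the kernel, and pairing it with [v] determines [f x]. *)
Lemma riesz (f : H -> R[i]) : (forall c x y, f (c *: x + y) = c * f x + f y) ->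
  (exists M, forall x, cmod (f x) <= M * nrm x) -> exists z, forall x, f x = ip x z.
Proof.
move=> fl [M hM].
have f0 : f 0 = 0.
  have := fl 1 0 0; rewrite scale1r addr0 mul1r => /esym/eqP.
  by rewrite -subr_eq0 addrK => /eqP.
have fZ c x : f (c *: x) = c * f x by have := fl c x 0; rewrite !addr0 f0 addr0.
have fD x y : f (x + y) = f x + f y by have := fl 1 x y; rewrite scale1r mul1r.
have fB x y : f (x - y) = f x - f y by rewrite fD -scaleN1r fZ mulN1r.
have [[x1 fx1]|nx] := pselect (exists x, f x != 0); last first.
  exists 0 => x; rewrite ip0r; apply/eqP/negPn/negP => fx; apply: nx; by exists x.
pose x0 := (f x1)^-1 *: x1.
have fx0 : f x0 = 1 by rewrite fZ mulVf.
have [||m am om] := @projection (fun w => f w = 0) x0 f0.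
- by move=> u v fu fv; rewrite fD fu fv addr0.
- by move=> c u fu; rewrite fZ fu mulr0.
(* [m] is only a limit of kernel vectors; boundedness of [f] puts it in the kernel. *)
have fm : f m = 0.
  apply/eqP; rewrite -cmod_eq0 eq_le cmod_ge0 andbT.
  apply/ler_addgt0Pr => e e0; rewrite add0r.
  have M1 : 0 < Num.max M 1 by rewrite lt_max ltr01 orbT.
  have [w fw hw] := am (e / Num.max M 1) (divr_gt0 e0 M1).
  have -> : f m = - f (w - m) by rewrite fB fw sub0r opprK.
  rewrite cmodN (le_trans (hM _)) //.
  rewrite (@le_trans _ _ (Num.max M 1 * nrm (w - m))) //.
    by rewrite ler_wpM2r ?nrm_ge0 // le_max lexx.
  by rewrite mulrC -ler_pdivlMr.
pose v := x0 - m.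
have fv : f v = 1 by rewrite fB fx0 fm subr0.
have v0 : v != 0 by apply/eqP => v0; move/eqP: fv; rewrite v0 f0 eq_sym oner_eq0.
have nv : 0 < nrm v ^+ 2 by rewrite exprn_gt0 // nrm_gt0.
exists ((nrm v ^+ 2)^-1%:C *: v) => x.
have : f (x - f x *: v) = 0 by rewrite fB fZ fv mulr1 subrr.
move=> /om; rewrite -/v ipC ipBl ipZl ip_nrm => /eqP.
rewrite fmorph_eq0 subr_eq0 => /eqP xv.
by rewrite ipZr xv conj_real mulrCA -rmorphM mulVf ?gt_eqF // rmorph1 mulr1.
Qed.

End HilbertSpace.

(** * Adjoint pairs and a criterion for invertibility *)

Section Adjoint.
Variables (R : realType) (H : completeNormedModType R[i]).
Variable ip : {dot H for @Num.conj R[i]}.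
Hypothesis hip : hilbert ip.
Implicit Types (A B : {linear H -> H}) (x y z : H).

Lemma linear_pack (f : H -> H) : linear f -> exists B, forall x, B x = f x.
Proof.
move=> fl; pose m := GRing.isLinear.Build _ _ _ _ f fl.
pose B : {linear H -> H} := HB.pack f m.
by exists B.
Qed.

Definition adjoint_pair A B := forall x y, ip (A x) y = ip x (B y).

(** By Riesz the set defining [adjoint] is nonempty, so [xget] does not return its default [0]. The
    bundled linear [B] replaces the bare function [adjoint ip A] from here on. *)
Lemma adjoint_pairP A : op_bounded A ->
  exists B, adjoint_pair A B /\ forall y, B y = adjoint ip A y.
Proof.
move=> [M M0 hM].
have ex y : exists z, forall x, ip (A x) y = ip x z.
  apply: (riesz hip) => [c u v|]; first by rewrite linearP ipDl ipZl.
  exists (M * nrm y) => x; apply: le_trans (ip_le hip _ _) _.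
  by rewrite mulrAC ler_wpM2r ?nrm_ge0.
have adjE x y : ip (A x) y = ip x (adjoint ip A y).
  by have := @xgetPex _ 0 [set z | forall x, ip (A x) y = ip x z] (ex y); exact.
have [|B hB] := @linear_pack (adjoint ip A).
  move=> c u v; apply: (ip_ext hip) => z.
  by rewrite -adjE !ipDr !ipZr !adjE.
by exists B; split => // x y; rewrite hB adjE.
Qed.

Lemma adjoint_pairC A B : adjoint_pair A B -> adjoint_pair B A.
Proof. by move=> h x y; rewrite ipC -h -ipC. Qed.

Lemma op_bounded_adjoint A B : adjoint_pair A B -> op_bounded A -> op_bounded B.
Proof.
move=> AB [M M0 hM]; exists M => // x.
have [->|Bx] := eqVneq (B x) 0; first by rewrite nrm0 mulr_ge0 ?nrm_ge0 // ltW.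
have B0 : 0 < nrm (B x) by rewrite nrm_gt0.
rewrite -(ler_pM2r B0) -expr2 -mulrA (mulrC (nrm x)).
have -> : nrm (B x) ^+ 2 = rip ip (A (B x)) x by rewrite /rip AB (ip_nrm hip).
by rewrite (le_trans (rip_le hip _ _)) // mulrA ler_wpM2r ?nrm_ge0.
Qed.

Lemma adjoint_pair_comm A1 A2 B1 B2 :
  adjoint_pair A1 B1 -> adjoint_pair A2 B2 ->
  (forall x, A1 (A2 x) = A2 (A1 x)) -> forall x, B1 (B2 x) = B2 (B1 x).
Proof.
by move=> h1 h2 h x; apply: (ip_ext hip) => z; rewrite -h1 -h2 -h h1 h2.
Qed.

Lemma adjoint_pair_shift A B c : adjoint_pair A B ->
  adjoint_pair (shift_op A c) (shift_op B (Num.conj c)).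
Proof. by move=> h x y; rewrite !shift_opE ipBl ipBr ipZl ipZr conjCK h. Qed.

Lemma bounded_below_pos A : bounded_below A ->
  exists2 C, 0 < C & forall x, nrm x <= C * nrm (A x).
Proof.
move=> [C hC]; exists (Num.max C 1); first by rewrite lt_max ltr01 orbT.
by move=> x; rewrite (le_trans (hC x)) // ler_wpM2r ?nrm_ge0 // le_max lexx.
Qed.

(** The lower bound for [A] makes it injective with closed range; the lower bound for [B] makes [B]
    injective, hence the range of [A] dense. *)
Lemma invertible_op_of_bounded_below A B : adjoint_pair A B ->
  op_bounded A -> bounded_below A -> bounded_below B -> invertible_op A.
Proof.
move=> AB [M M0 hM] /bounded_below_pos[C C0 hC] [D hD].
have inj x y : A x = A y -> x = y.
  move=> Axy; apply/eqP; rewrite -subr_eq0 -nrm_eq0 eq_le nrm_ge0 andbT.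
  by rewrite (le_trans (hC _)) // linearB Axy subrr nrm0 mulr0.
have surj y : exists x, A x = y.
  have [||c u|m am om] := @projection _ _ ip hip (fun w => exists v, A v = w) y.
  - by exists 0; rewrite linear0.
  - by move=> _ _ [u <-] [v <-]; exists (u + v); rewrite linearD.
  - by move=> [v <-]; exists (c *: v); rewrite linearZ.
  have ym : y = m.
    apply/eqP; rewrite -subr_eq0 -nrm_eq0 eq_le nrm_ge0 andbT.
    have -> : 0 = D * nrm (B (y - m)); last exact: hD.
    have -> : B (y - m) = 0.
      apply: (ip_ext hip) => z; rewrite ip0r -AB ipC om ?rmorph0 //.
      by exists z.
    by rewrite nrm0 mulr0.
  have ak k : exists v, nrm (A v - m) <= k.+1%:R^-1.
    have k0 : 0 < k.+1%:R^-1 :> R by rewrite invr_gt0.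
    by have [_ [v <-] hv] := am _ k0; exists v.
  have [s hs] := choice ak.
  have small e : 0 < e -> exists N, forall k, (N <= k)%N -> nrm (A (s k) - m) <= e.
    move=> e0; exists (Num.truncn e^-1) => k Nk; apply: le_trans (hs k) _.
    rewrite invf_ple ?posrE // ltW // (lt_le_trans (truncnS_gt _)) //.
    by rewrite ler_nat.
  have [|x hx] := @nrm_complete R H s.
    move=> e e0; have [|N hN] := small (e / (2 * C)).
      by rewrite divr_gt0 // mulr_gt0.
    exists N => k l Nk Nl; apply: le_trans (hC _) _.
    rewrite linearB -ler_pdivlMl // (le_trans (nrm_tri _ m _)) //.
    rewrite (nrm_distC m) (le_trans (lerD (hN _ Nk) (hN _ Nl))) //.
    have -> // : e / (2 * C) + e / (2 * C) = C^-1 * e.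
    by field; rewrite gt_eqF.
  exists x; rewrite ym; apply/eqP; rewrite -subr_eq0 -nrm_eq0 eq_le nrm_ge0 andbT.
  apply/ler_addgt0Pr => e e0; rewrite add0r.
  have [N1 h1] := small _ (divr_gt0 e0 (ltr0n _ 2)).
  have [|N2 h2] := hx (e / (2 * M)); first by rewrite divr_gt0 // mulr_gt0.
  apply: (le_trans (nrm_tri _ (A (s (maxn N1 N2))) _)).
  have l1 := h1 _ (leq_maxl N1 N2); have l2 := h2 _ (leq_maxr N1 N2).
  rewrite -linearB (nrm_distC (A _) m) in l1 *.
  have := hM (s (maxn N1 N2) - x); have := ler_wpM2l (ltW M0) l2.
  have -> : M * (e / (2 * M)) = e / 2 by field; rewrite gt_eqF.
  rewrite -[x - _]opprB linearN nrmN (nrm_distC m) in l1 *; lra.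
have [s hs] := choice surj.
have [|S hS] := @linear_pack s.
  by move=> c u v; apply: inj; rewrite linearP !hs.
exists S; split; last by move=> x; rewrite hS hs.
  apply/op_boundedP; exists C => // x; rewrite hS.
  by rewrite (le_trans (hC _)) // hs.
by move=> x; rewrite hS; apply: inj; rewrite hs.
Qed.

Lemma invertible_op_bounded_below A : invertible_op A -> bounded_below A.
Proof.
move=> [S [/op_boundedP[M M0 hM] AS SA]]; exists M => x.
by rewrite -{1}(AS x) hM.
Qed.

Lemma invertible_op_bounded_below_adjoint A B : adjoint_pair A B ->
  invertible_op A -> bounded_below B.
Proof.
move=> AB [S [/op_boundedP[M M0 hM] AS SA]]; exists M => x.
have [->|x0] := eqVneq x 0; first by rewrite linear0 nrm0 mulr0.
have nx : 0 < nrm x by rewrite nrm_gt0.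
rewrite -(ler_pM2r nx) -expr2.
have -> : nrm x ^+ 2 = rip ip (S x) (B x) by rewrite /rip -AB SA (ip_nrm hip).
rewrite (le_trans (rip_le hip _ _)) // mulrAC.
by rewrite ler_wpM2r ?nrm_ge0.
Qed.

End Adjoint.

(** * The Koszul complex *)

Section Koszul.
Variables (R : realType) (H : completeNormedModType R[i]) (n : nat).
Variable T : 'I_n -> {linear H -> H}.
Hypothesis exT : koszul_exact (fun j => T j : H -> H).
Implicit Types (x y : H) (S : {set 'I_n}).

Let koszulE xi S : koszul (fun j => T j : H -> H) xi S = \sum_(j in S)
     (-1) ^+ #|[set i in S | (i < j)%N]%SET| *: T j (xi (S :\ j)%SET).
Proof. by rewrite ffunE. Qed.

Lemma koszul_cycle xi : koszul (fun j => T j : H -> H) xi = 0 ->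
  exists eta, koszul (fun j => T j : H -> H) eta = xi.
Proof.
move=> xi0; have : range (koszul (fun j => T j : H -> H)) xi by rewrite exT.
by move=> [eta _ <-]; exists eta.
Qed.

(** Degree zero: [x] placed at the empty set is a cycle, and a boundary vanishes at the empty
    set. *)
Lemma koszul_exact_injective x : (forall i, T i x = 0) -> x = 0.
Proof.
move=> Tx; pose xi : {ffun {set 'I_n} -> H} :=
  [ffun S => if S == finset.set0 then x else 0].
have [|eta he] := @koszul_cycle xi.
  apply/ffunP => S; rewrite koszulE ffunE big1 // => j _; rewrite ffunE.
  by case: ifP => _; [rewrite Tx scaler0 | rewrite linear0 scaler0].
have := congr1 (fun f : {ffun {set 'I_n} -> H} => f finset.set0) he.
rewrite koszulE [RHS]ffunE eqxx big1 // => j.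
by rewrite finset.inE.
Qed.

(** Top degree: [x] placed at the full set is a cycle, since no [S :\ j] with [j] in [S] is full. *)
Lemma koszul_exact_surjective x :
  exists y : 'I_n -> H, x = \sum_i T i (y i).
Proof.
pose xi : {ffun {set 'I_n} -> H} := [ffun S => if S == finset.setT then x else 0].
have [|eta he] := @koszul_cycle xi.
  apply/ffunP => S; rewrite koszulE ffunE big1 // => j jS; rewrite ffunE.
  case: eqP => [ST|_]; last by rewrite linear0 scaler0.
  have : j \in (S :\ j)%SET by rewrite ST finset.inE.
  by rewrite finset.in_setD1 eqxx.
have := congr1 (fun f : {ffun {set 'I_n} -> H} => f finset.setT) he.
rewrite koszulE [RHS]ffunE eqxx => <-.
exists (fun j : 'I_n => (-1) ^+ #|[set i in [set: 'I_n] | (i < j)%N]%SET| *: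
  eta (finset.setT :\ j)%SET).
by apply: eq_big => [j|j _]; rewrite ?finset.inE ?linearZ.
Qed.

(** Degree one: the element [sum_i z_i e_i] has boundary [T a (z b) - T b (z a)] at a pair [a < b]
    and [0] at all other sets. The component at the empty set of a preimage is the required [x]. *)
Lemma koszul_exact_middle (z : 'I_n -> H) :
  (forall i j, T i (z j) = T j (z i)) -> exists x, forall i, z i = T i x.
Proof.
move=> Tz; pose xi : {ffun {set 'I_n} -> H} :=
  [ffun S : {set 'I_n} => \sum_(i | S == [set i]%SET) z i].
have xi1 i : xi [set i]%SET = z i.
  rewrite ffunE (big_pred1 i) // => j /=; rewrite eq_sym.
  by apply/eqP/eqP => [/finset.set1_inj|->].
have xi0 S : #|S| != 1%N -> xi S = 0.
  by move=> S1; rewrite ffunE big1 // => i /eqP Si; rewrite Si finset.cards1 in S1.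
have [|eta he] := @koszul_cycle xi.
  apply/ffunP => S; rewrite koszulE ffunE.
  have [S2|S2] := eqVneq #|S| 2%N; last first.
    rewrite big1 // => j jS; rewrite xi0; first by rewrite linear0 scaler0.
    by move: S2; rewrite (finset.cardsD1 j) jS.
  have /cards2P[a [b [ab SE]]] : #|S| == 2%N by rewrite S2.
  wlog lt_ab : a b ab SE / (a < b)%N.
    move=> wl; have [lt|lt|/val_inj e] := ltngtP a b; first exact: (wl a b ab SE lt).
      apply: (wl b a _ _ lt); [by rewrite eq_sym | by rewrite SE finset.setUC].
    by rewrite e eqxx in ab.
  have Sa : (S :\ a = [set b])%SET.
    apply/finset.setP => i; rewrite SE !finset.inE.
    by have [->|] := eqVneq i a; rewrite //= (negPf ab).
  have Sb : (S :\ b = [set a])%SET.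
    apply/finset.setP => i; rewrite SE !finset.inE.
    by have [->|] := eqVneq i b; rewrite /= ?orbF // eq_sym (negPf ab).
  have sa : #|[set i in S | (i < a)%N]%SET| = 0%N.
    apply/eqP; rewrite finset.cards_eq0; apply/eqP/finset.setP => i.
    rewrite SE !finset.inE; have [->|_] := eqVneq i a; first by rewrite ltnn.
    by have [->|//] := eqVneq i b; rewrite /= ltnNge ltnW.
  have sb : #|[set i in S | (i < b)%N]%SET| = 1%N.
    apply/eqP/cards1P; exists a; apply/finset.setP => i.
    rewrite SE !finset.inE; have [->|_] := eqVneq i a; first by rewrite lt_ab.
    by have [->|//] := eqVneq i b; rewrite ltnn andbF.
  rewrite (bigD1 a) /=; last by rewrite SE !finset.inE eqxx.
  rewrite (big_pred1 b); last first.
    move=> i; rewrite SE !finset.inE /=; have [->|] := eqVneq i a => //=.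
      by rewrite (negPf ab).
    by rewrite andbT.
  by rewrite Sa Sb !xi1 sa sb scale1r expr1 scaleN1r Tz subrr.
exists (eta finset.set0) => i; rewrite -xi1 -he koszulE finset.big_set1.
have -> : ([set i] :\ i = finset.set0)%SET.
  by apply/finset.setP => j; rewrite !finset.inE andNb.
have -> : #|[set j in [set i] | (j < i)%N]%SET| = 0%N.
  apply/eqP; rewrite finset.cards_eq0; apply/eqP/finset.setP => j.
  by rewrite !finset.inE; have [->|//] := eqVneq j i; rewrite ltnn.
by rewrite scale1r.
Qed.

End Koszul.

(** * Lower bounds at the two ends of an exact Koszul complex *)

Section ClosedRange.
Variables (R : realType) (H : completeNormedModType R[i]).
Variable ip : {dot H for @Num.conj R[i]}.
Hypothesis hip : hilbert ip.
Variables (n : nat) (T B : 'I_n -> {linear H -> H}).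
Hypothesis exT : koszul_exact (fun j => T j : H -> H).
Hypothesis bT : forall i, op_bounded (T i).
Hypothesis TT : forall i j x, T i (T j x) = T j (T i x).
Hypothesis TB : forall i, adjoint_pair ip (T i) (B i).

Lemma seminorm_nrm (V : normedModType R[i]) : seminorm (@nrm R V).
Proof.
by split; [exact: nrm_ge0 | exact: nrmD | exact: nrmZ].
Qed.

Lemma seminorm_ip y : seminorm (fun x => cmod (ip x y)).
Proof.
split=> [x|x z|c x]; first exact: cmod_ge0.
  by rewrite ipDl cmodD.
by rewrite ipZl cmodM.
Qed.

Lemma seminorm_sum (A : 'I_n -> {linear H -> H}) : seminorm (fun x => \sum_i nrm (A i x)).
Proof.
split=> [x|x y|c x].
- by apply: sumr_ge0 => i _; exact: nrm_ge0.
- by rewrite -big_split ler_sum // => i _; rewrite linearD nrmD.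
- by rewrite mulr_sumr; apply: eq_bigr => i _; rewrite linearZ nrmZ.
Qed.

(** Rescaling by [q x + d] with [d > 0], instead of [q x], also covers the vectors with [q x = 0];
    then [d] tends to [0]. *)
Lemma seminorm_scale (p q : H -> R) C : seminorm p -> seminorm q ->
  (forall x, q x <= 1 -> p x <= C) -> forall x, p x <= C * q x.
Proof.
move=> [p0 pD pZ] [q0 qD qZ] h x.
have C0 : 0 <= C.
  apply: le_trans (p0 0) (h 0 _); by rewrite -(scale0r 0) qZ cmod0 mul0r ler01.
apply/ler_addgt0Pr => e e0.
pose d := e / (C + 1).
have C1 : 0 < C + 1 by rewrite ltr_wpDl.
have d0 : 0 < d by rewrite divr_gt0.
have qd : 0 < q x + d by rewrite ltr_wpDl.
have := h ((q x + d)^-1%:C *: x).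
rewrite qZ pZ !cmod_real ?invr_ge0 ?(ltW qd) // => hh.
have : p x <= C * (q x + d).
  rewrite mulrC -ler_pdivrMl //; apply: hh.
  by rewrite ler_pdivrMl // mulr1 lerDl ltW.
have : C * d <= e by rewrite /d mulrCA ger_pMr // ler_pdivrMr // mul1r lerDl.
lra.
Qed.

(** Writing [z = sum_i T_i y_i] bounds [ip z x] uniformly over all [x] with
    [sum_i nrm (B i x) <= 1]. Uniform boundedness of these functionals, evaluated at [z = x], bounds
    [nrm x]. *)
Lemma row_bounded_below : exists C, forall x, nrm x <= C * \sum_i nrm (B i x).
Proof.
pose I := {x : H | \sum_i nrm (B i x) <= 1}.
have [|||C hC] := @uniform_boundedness R H (@nrm R H) I
    (fun x z => cmod (ip z (sval x))) (seminorm_nrm H) (@nrm_complete R H).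
- by move=> i; exact: seminorm_ip.
- move=> [y hy]; exists (nrm y) => x; rewrite mulrC; exact: ip_le.
- move=> z; have [y ->] := koszul_exact_surjective exT z.
  exists (\sum_i nrm (y i)) => -[x /= hx]; rewrite ip_suml.
  apply: le_trans (_ : \sum_i cmod (ip (T i (y i)) x) <= _).
    elim/big_ind2: _ => [|a u b v au bv|//]; first by rewrite cmod0.
    exact: le_trans (cmodD _ _) (lerD au bv).
  apply: ler_sum => i _; rewrite TB (le_trans (ip_le hip _ _)) //.
  rewrite ler_piMr ?nrm_ge0 //; apply: le_trans hx.
  by rewrite (bigD1 i) //= lerDl sumr_ge0 // => j _; exact: nrm_ge0.
exists (Num.max C 0); apply: seminorm_scale => [||x hx].
- exact: seminorm_nrm.
- exact: seminorm_sum.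
have [->|x0] := eqVneq x 0; first by rewrite nrm0 le_max lexx orbT.
have nx : 0 < nrm x by rewrite nrm_gt0.
have := hC (exist _ x hx) x; rewrite /= (ip_nrm hip) cmod_real ?sqr_ge0 // expr2.
by rewrite ler_pM2r // le_max => ->.
Qed.

(** For a Cauchy sequence [s] the limits [z i] of [T i (s m)] satisfy [T i (z j) = T j (z i)], so
    exactness in degree one gives [x] with [z i = T i x]. *)
Lemma column_complete : complete_for (fun x => \sum_i nrm (T i x)).
Proof.
have [q0 qD qZ] := seminorm_sum T.
have le_q i x : nrm (T i x) <= \sum_i nrm (T i x).
  by rewrite (bigD1 i) //= lerDl sumr_ge0 // => j _; exact: nrm_ge0.
move=> s cs.
have lim i : exists z, forall e, 0 < e -> exists N, forall m, (N <= m)%N ->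
    nrm (T i (s m) - z) <= e.
  apply: nrm_complete => e e0; have [N hN] := cs e e0; exists N => m k Nm Nk.
  by rewrite -linearB (le_trans (le_q i _)) // hN.
have [z hz] := choice lim.
have Tz i j : T i (z j) = T j (z i).
  apply/eqP; rewrite -subr_eq0 -nrm_eq0 eq_le nrm_ge0 andbT.
  apply/ler_addgt0Pr => e e0; rewrite add0r.
  have [M M0 hM] := bT i; have [K K0 hK] := bT j.
  have [|N hN] := hz j (e / (2 * M)); first by rewrite divr_gt0 // mulr_gt0.
  have [|N' hN'] := hz i (e / (2 * K)); first by rewrite divr_gt0 // mulr_gt0.
  have h1 := ler_wpM2l (ltW M0) (hN _ (leq_maxl N N')).
  have h2 := ler_wpM2l (ltW K0) (hN' _ (leq_maxr N N')).
  have e1 : M * (e / (2 * M)) = e / 2 by field; rewrite gt_eqF.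
  have e2 : K * (e / (2 * K)) = e / 2 by field; rewrite gt_eqF.
  rewrite e1 in h1; rewrite e2 in h2.
  move: (s _) h1 h2 => x h1 h2.
  apply: (le_trans (nrm_tri _ (T i (T j x)) _)).
  have := hM (T j x - z j); have := hK (T i x - z i).
  rewrite !linearB TT (nrm_distC (T i (z j))); lra.
have [x hx] := koszul_exact_middle exT Tz.
exists x => e e0.
(* The denominator is [n.+1] so that it is nonzero for [n = 0]. *)
have en : 0 < e / n.+1%:R by rewrite divr_gt0.
have [N hN] := choice (fun i => hz i _ en).
exists (\max_i N i)%N => m Nm.
apply: (@le_trans _ _ (\sum_(i < n) e / n.+1%:R)).
  apply: ler_sum => i _; rewrite linearB -hx; apply: hN.
  by apply: leq_trans Nm; exact: leq_bigmax.
rewrite sumr_const card_ord -[leLHS]mulr_natr mulrAC ler_pdivrMr //.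
by rewrite ler_pM2l // ler_nat.
Qed.

(* The pairings with the range of the adjoint [u |-> sum_i T_i^* u_i] are
   continuous for the complete norm [sum_i |T_i x|]; this range is dense because
   [T] is injective. *)
Lemma column_bounded_below : exists C, forall x, nrm x <= C * \sum_i nrm (T i x).
Proof.
pose q x := \sum_i nrm (T i x).
have sq : seminorm q := seminorm_sum T.
have [q0 _ _] := sq.
pose w (u : 'I_n -> H) := \sum_i B i (u i).
have ipw x u : ip x (w u) = \sum_i ip (T i x) (u i).
  by rewrite ip_sumr; apply: eq_bigr => i _; rewrite TB.
pose I := {u : 'I_n -> H | nrm (w u) <= 1}.
have [|||C hC] := @uniform_boundedness R H q I
    (fun u x => cmod (ip x (w (sval u)))) sq column_complete.
- by move=> i; exact: seminorm_ip.
- move=> [u hu]; exists (\sum_i nrm (u i)) => x /=; rewrite ipw.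
  apply: le_trans (_ : \sum_i cmod (ip (T i x) (u i)) <= _).
    elim/big_ind2: _ => [|a b c d ab cd|//]; first by rewrite cmod0.
    exact: le_trans (cmodD _ _) (lerD ab cd).
  rewrite mulr_suml ler_sum // => i _.
  rewrite (le_trans (ip_le hip _ _)) // mulrC ler_wpM2l ?nrm_ge0 //.
  by rewrite /q (bigD1 i) //= lerDl sumr_ge0 // => j _; exact: nrm_ge0.
- move=> x; exists (nrm x) => -[u /= hu]; apply: le_trans (ip_le hip _ _) _.
  by rewrite ler_piMr ?nrm_ge0.
have [C' C'0 {}hC] : exists2 C', 0 <= C' & forall u, nrm (w u) <= 1 ->
    forall x, cmod (ip x (w u)) <= C' * q x.
  exists (Num.max C 0); first by rewrite le_max lexx orbT.
  move=> u hu x; apply: le_trans (hC (exist _ u hu) x) _.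
  by rewrite ler_wpM2r ?q0 // le_max lexx.
exists C' => x; rewrite -/(q x).
have hw u : cmod (ip x (w u)) <= C' * q x * nrm (w u).
  have [wu|wu] := eqVneq (nrm (w u)) 0.
    by move/eqP: wu; rewrite nrm_eq0 => /eqP ->; rewrite ip0r cmod0 nrm0 mulr0.
  have w0 : 0 < nrm (w u) by rewrite lt_def wu nrm_ge0.
  have ws : w (fun i => (nrm (w u))^-1%:C *: u i) = (nrm (w u))^-1%:C *: w u.
    by rewrite /w scaler_sumr; apply: eq_bigr => i _; rewrite linearZ.
  have := hC (fun i => (nrm (w u))^-1%:C *: u i).
  rewrite ws nrmZ cmod_real ?invr_ge0 ?nrm_ge0 // mulVf // => /(_ (lexx 1) x).
  by rewrite ipZr cmodM cmod_conj cmod_real ?invr_ge0 ?nrm_ge0 // mulrC ler_pdivrMr.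
have [|u v [a <-] [b <-]|c u [a <-]|m am om] :=
    @projection _ _ ip hip (fun y => exists u, w u = y) x.
- by exists (fun=> 0); rewrite /w big1 // => i _; rewrite linear0.
- exists (fun i => a i + b i); rewrite /w -big_split; apply: eq_bigr => i _.
  by rewrite linearD.
- exists (fun i => c *: a i); rewrite /w scaler_sumr; apply: eq_bigr => i _.
  by rewrite linearZ.
have xm : x = m.
  apply/eqP; rewrite -subr_eq0; apply/eqP/(koszul_exact_injective exT) => i.
  apply: (ip_ext hip) => z; rewrite ip0r ipC TB om ?rmorph0 //.
  exists (fun j => if j == i then z else 0).
  by rewrite /w (bigD1 i) //= eqxx big1 ?addr0 // => j /negPf ->; rewrite linear0.
rewrite -{m}xm in am {om}.
have [->|x0] := eqVneq x 0; first by rewrite nrm0 mulr_ge0.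
have nx : 0 < nrm x by rewrite nrm_gt0.
rewrite -(ler_pM2r nx) -expr2; apply/ler_addgt0Pr => e e0.
(* [K] is the total coefficient of the approximation error [nrm (w u - x)] in the final estimate. *)
pose K := nrm x + C' * q x.
have K0 : 0 < K by rewrite ltr_wpDr // mulr_ge0.
have [_ [u <-] hu] := am (e / K) (divr_gt0 e0 K0).
have : cmod (ip x x) <= cmod (ip x (w u)) + cmod (ip x (x - w u)).
  by rewrite -{2}(subrK (w u) x) ipDr addrC cmodD.
rewrite (ip_nrm hip) cmod_real ?sqr_ge0 // => h1.
have h2 := ip_le hip x (x - w u); rewrite nrm_distC in h2.
have h3 := hw u.
have h4 : nrm (w u) <= nrm x + nrm (w u - x).
  by rewrite -{1}(subrK x (w u)) addrC nrmD.
have h5 := ler_wpM2l (mulr_ge0 C'0 (q0 x)) h4.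
have h6 : K * nrm (w u - x) <= e by rewrite mulrC -ler_pdivlMr.
rewrite /K in h6; lra.
Qed.

End ClosedRange.

(** * Hereditary forms and Stein inequalities *)

Lemma ord_chain n (P : 'I_n.+1 -> Prop) :
  P ord_max -> (forall j : 'I_n, P (nxt j) -> P (cur j)) -> forall i, P i.
Proof.
move=> Pmax step.
suff main k (i : 'I_n.+1) : (n - i = k)%N -> P i by move=> i; exact: (main (n - i)%N).
elim: k i => [|k IH] i ik.
  have -> // : i = ord_max.
  apply/val_inj => /=; apply/eqP; rewrite eqn_leq -ltnS ltn_ord /=.
  by rewrite -subn_eq0 ik.
have lt_in : (i < n)%N by rewrite -subn_gt0 ik.
have -> : i = cur (Ordinal lt_in) by exact/val_inj.
by apply/step/IH; rewrite lift0 /= subnS ik.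
Qed.

Section Forms.
Variables (R : realType) (H : completeNormedModType R[i]) (n : nat).
Variable T : 'I_n -> {linear H -> H}.
Hypothesis bT : forall i, op_bounded (T i).
Hypothesis TT : forall i j x, T i (T j x) = T j (T i x).
Implicit Types (P Q : mpoly.mpoly n R[i]) (m : mpoly.multinom n) (x : H).

(** [oppow] with its list of indices as a parameter, to allow induction on the list. *)
Let mon (s : seq 'I_n) m : H -> H :=
  \big[(fun f g => f \o g)/id]_(j <- s) iter (m j) (T j).

Let mon_cons j s m x : mon (j :: s) m x = iter (m j) (T j) (mon s m x).
Proof. by rewrite /mon big_cons. Qed.

Let iter_comm i j k x : iter k (T j) (T i x) = T i (iter k (T j) x).
Proof. by elim: k => //= k ->; rewrite TT. Qed.

Let mon_comm s m i x : mon s m (T i x) = T i (mon s m x).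
Proof.
elim: s x => [|j s IH] x; first by rewrite /mon !big_nil.
by rewrite !mon_cons IH iter_comm.
Qed.

Let mon_linear s m : linear (mon s m).
Proof.
elim: s => [|j s IH] c x y; first by rewrite /mon !big_nil.
by rewrite !mon_cons IH iter_linearD iter_linearZ.
Qed.

Let mon_bounded s m : op_bounded (mon s m).
Proof.
elim: s => [|j s [M M0 IH]].
  by exists 1 => // x; rewrite /mon big_nil mul1r.
have [K K0 hK] := bT j; exists (K ^+ m j * M); first by rewrite mulr_gt0 ?exprn_gt0.
move=> x; rewrite mon_cons; apply: (le_trans (nrm_iter (ltW K0) hK _ _)).
by rewrite -mulrA ler_wpM2l ?exprn_ge0 // ltW.
Qed.

Let mon_shift s m i x : uniq s ->
  mon s (mpoly.mnm_add m (mpoly.mnm1 i)) x = mon s m (if i \in s then T i x else x).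
Proof.
elim: s => [_|j s IH /= /andP[js us]]; first by rewrite /mon !big_nil.
rewrite !mon_cons IH // mpoly.mnmDE mpoly.mnm1E in_cons.
have [->|ij] := eqVneq i j.
  by rewrite (negPf js) /= addn1 iterSr mon_comm.
by rewrite addn0.
Qed.

Lemma oppow_linear m : linear (oppow (fun i => T i : H -> H) m).
Proof. exact: mon_linear. Qed.

Lemma oppow_bounded m : op_bounded (oppow (fun i => T i : H -> H) m).
Proof. exact: mon_bounded. Qed.

Lemma oppow_shift m i x :
  oppow (fun i => T i : H -> H) (mpoly.mnm_add m (mpoly.mnm1 i)) x =
  oppow (fun i => T i : H -> H) m (T i x).
Proof.
rewrite [LHS](mon_shift _ _ _ (index_enum_uniq _)).
by rewrite mem_index_enum.
Qed.

Lemma oppow0 x : oppow (fun i => T i : H -> H) (@mpoly.mnm0 n) x = x.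
Proof.
rewrite -[LHS]/(mon (index_enum _) _ x); elim: (index_enum _) => [|j s IH].
  by rewrite /mon big_nil.
by rewrite mon_cons mpoly.mnm0E IH.
Qed.

(** For real coefficients this is the quadratic form of the operator [sum_m P_m T^{*m} T^m], written
    without adjoints. *)
Definition hereditary_form P x : R := \sum_(m <- mpoly.msupp P)
  complex.Re (mpoly.mcoeff m P) * nrm (oppow (fun i => T i : H -> H) m x) ^+ 2.

Lemma hereditary_formE (s : seq (mpoly.multinom n)) P x :
  uniq s -> {subset mpoly.msupp P <= s} ->
  hereditary_form P x = \sum_(m <- s)
  complex.Re (mpoly.mcoeff m P) * nrm (oppow (fun i => T i : H -> H) m x) ^+ 2.
Proof.
move=> us Ps; rewrite /hereditary_form.
rewrite [RHS](bigID (mem (mpoly.msupp P))) /= [X in _ + X]big1 ?addr0; last first.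
  by move=> m /mpoly.memN_msupp_eq0 ->; rewrite raddf0 mul0r.
rewrite -[RHS]big_filter; apply: perm_big; apply: uniq_perm.
- exact: mpoly.msupp_uniq.
- exact: filter_uniq.
- by move=> m; rewrite mem_filter; apply/idP/andP => [mP|[]//]; split; rewrite ?Ps.
Qed.

Lemma hereditary_formB P Q x :
  hereditary_form (P - Q) x = hereditary_form P x - hereditary_form Q x.
Proof.
pose s := undup (mpoly.msupp P ++ mpoly.msupp Q).
have us : uniq s by exact: undup_uniq.
rewrite !(@hereditary_formE s) //; first 1 last.
- by move=> m mQ; rewrite mem_undup mem_cat mQ orbT.
- by move=> m mP; rewrite mem_undup mem_cat mP.
- by move=> m /mpoly.msuppB_le; rewrite mem_undup.
rewrite -sumrB; apply: eq_bigr => m _.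
by rewrite mpoly.mcoeffB raddfB mulrBl.
Qed.

Lemma hereditary_formMX P i x :
  hereditary_form (P * mpoly.mpolyX R[i] (mpoly.mnm1 i)) x = hereditary_form P (T i x).
Proof.
rewrite /hereditary_form (perm_big _ (mpoly.msuppMX _ _)) big_map.
apply: eq_bigr => m _; rewrite mpoly.mcoeffMX mpoly.addmC; congr (_ * nrm _ ^+ 2).
exact: oppow_shift.
Qed.

Lemma hereditary_form1 x : hereditary_form 1 x = nrm x ^+ 2.
Proof.
by rewrite /hereditary_form mpoly.msupp1 big_seq1 mpoly.mcoeff1 eqxx mul1r oppow0.
Qed.

Lemma hereditary_form_bounded P :
  exists2 K, 0 <= K & forall x, - (K * nrm x ^+ 2) <= hereditary_form P x.
Proof.
rewrite /hereditary_form; elim: (mpoly.msupp P) => [|m s [K K0 IH]].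
  by exists 0 => // x; rewrite big_nil mul0r oppr0.
have [M M0 hM] := oppow_bounded m.
exists (`|complex.Re (mpoly.mcoeff m P)| * M ^+ 2 + K).
  by rewrite addr_ge0 // mulr_ge0 // sqr_ge0.
move=> x; rewrite big_cons mulrDl opprD lerD //.
move: (complex.Re _) => c.
have h : nrm (oppow (fun i => T i : H -> H) m x) ^+ 2 <= M ^+ 2 * nrm x ^+ 2.
  by rewrite -exprMn lerXn2r ?nnegrE ?mulr_ge0 ?nrm_ge0 // ltW.
have h1 := ler_wpM2l (normr_ge0 c) h.
have h2 : - c * nrm (oppow (fun i => T i : H -> H) m x) ^+ 2 <=
    `|c| * nrm (oppow (fun i => T i : H -> H) m x) ^+ 2.
  by rewrite ler_wpM2r ?sqr_ge0 // -normrN ler_norm.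
lra.
Qed.

End Forms.

Section Stein.
Variables (R : realType) (H : completeNormedModType R[i]).

(* For [S = A B^-1] one has [h (S x) <= h x], and the powers of [S] tend to [0]. *)
Lemma stein_positivity (A B : {linear H -> H}) (h : H -> R) K :
  op_bounded A -> op_bounded B -> invertible_op B ->
  (forall z, cmod z <= 1 -> bounded_below (lincomb_op B A 1 (- z))) ->
  (forall x, - (K * nrm x ^+ 2) <= h x) ->
  (forall x, h (A x) <= h (B x)) -> forall x, 0 <= h x.
Proof.
move=> [M M0 hM] [L L0 hL] [C [/op_boundedP[N N0 hN] BC CB]] bb hK hAB.
pose S : {linear H -> H} := A \o C.
have SE x : S x = A (C x) by [].
have hS x : h (S x) <= h x by rewrite SE (le_trans (hAB _)) // CB.
have MN0 : 0 < M * N by rewrite mulr_gt0.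
have nS x : nrm (S x) <= M * N * nrm x.
  by rewrite SE (le_trans (hM _)) // -mulrA ler_wpM2l // ltW.
(* With [q = 0] and radius [1], some iterate of [S] has norm at most [1/4]; the resolvent bound
   comes from [1 - z S = (B - z A) C]. *)
have [|||||n n0 [e e0 hn]] := @power_small R H S (fun=> 0) (M * N) _ _ _ MN0 nS _ 1 ler01.
- by [].
- by move=> *; rewrite addr0.
- by move=> *; rewrite mulr0.
- by move=> *; rewrite mulr0.
- move=> z z1; have [D D0 hD] := bounded_below_pos (bb z z1).
  exists (L * D) => x; rewrite addr0 -mulrA -[X in nrm X <= _](CB x).
  rewrite (le_trans (hL _)) // ler_wpM2l ?(ltW L0) // (le_trans (hD _)) //.
  by rewrite lincomb_opE scale1r CB scaleNr.
have hn4 x : nrm (iter n S x) <= nrm x / 4.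
  by have := hn x; rewrite expr1n mul1r mulr0 addr0.
(* Each block of [n] iterations does not increase [h] and divides the norm by [4], so the lower
   bound improves to [0] as [k] grows. *)
have hnk k x : - (Num.max K 0 * (4^-1 ^+ k * nrm x) ^+ 2) <= h x.
  have hpos : 0 <= Num.max K 0 by rewrite le_max lexx orbT.
  elim: k x => [|k IH] x.
    apply: le_trans (hK x); rewrite expr0 mul1r lerN2 ler_wpM2r ?sqr_ge0 //.
    by rewrite le_max lexx.
  have hit : h (iter n S x) <= h x.
    elim: (n) => [|j IHj]; first by [].
    by rewrite iterS (le_trans (hS _)).
  apply: le_trans hit; apply: le_trans (IH _); rewrite lerN2 ler_wpM2l //.
  have p4 : 0 <= 4^-1 ^+ k :> R by rewrite exprn_ge0 // invr_ge0.
  have p5 : 0 <= 4^-1 ^+ k.+1 :> R by rewrite exprn_ge0 // invr_ge0.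
  rewrite lerXn2r ?nnegrE ?mulr_ge0 ?nrm_ge0 //.
  by rewrite exprSr -mulrA ler_wpM2l // mulrC.
move=> x; apply/ler_addgt0Pr => e' e'0.
have K0 : 0 <= Num.max K 0 * nrm x ^+ 2.
  by rewrite mulr_ge0 ?sqr_ge0 // le_max lexx orbT.
have : `|4^-1 : R| < 1 by rewrite ger0_norm ?invr_ge0 // invf_lt1 // ltr1n.
move=> /cvg_expr /cvgrPdist_lt /(_ (e' / (Num.max K 0 * nrm x ^+ 2 + 1))); case.
  by rewrite divr_gt0 // ltr_wpDl.
move=> k _ hk; have {hk} := hk k (leqnn k); have := hnk k x.
rewrite sub0r normrN ger0_norm ?exprn_ge0 ?invr_ge0 //.
have : 4^-1 ^+ k <= 1 :> R by rewrite exprn_ile1 ?invr_ge0 // invf_le1 // ler1n.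
have : 0 <= 4^-1 ^+ k :> R by rewrite exprn_ge0 ?invr_ge0.
rewrite exprMn ltr_pdivlMr; last by rewrite ltr_wpDl.
move: (4^-1 ^+ k) => t t0 t1 h1 h2.
have h3 : t ^+ 2 <= t by rewrite expr2 ler_piMl.
have := ler_wpM2l K0 h3; lra.
Qed.

End Stein.

(** * Hartogs contractions *)

Section AffineCombination.
Variables (R : realType) (V : normedModType R[i]) (n : nat).
Variable T : 'I_n -> {linear V -> V}.
Hypothesis bT : forall i, op_bounded (T i).
Hypothesis TT : forall i j x, T i (T j x) = T j (T i x).

Lemma defect_ge (z : 'I_n -> R[i]) i x : nrm (T i x - z i *: x) <= defect T z x.
Proof. by rewrite /defect (bigD1 i) //= lerDl sumr_ge0 // => j _; exact: nrm_ge0. Qed.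

(** The symbol is [c0 + c * z i + d * z j]. As [i = j] and zero coefficients are allowed, this
    covers [T i - l], [1 - z T i] and [T (nxt j) - z T (cur j)] alike. *)
Lemma affine_bounded_below (c0 c d : R[i]) i j :
  (forall z : 'I_n -> R[i], c0 + c * z i + d * z j = 0 ->
     exists C, forall x, nrm x <= C * defect T z x) ->
  bounded_below (fun x => c0 *: x + c *: T i x + d *: T j x).
Proof.
move=> h; pose A := lincomb_op (lincomb_op idfun (T i) c0 c) (T j) 1 d.
have AE x : A x = c0 *: x + c *: T i x + d *: T j x.
  by rewrite lincomb_opE scale1r lincomb_opE.
suff [C hC] : bounded_below A by exists C => x; rewrite -AE.
apply: (@bounded_below_of_symbol _ _ _ T A bT TT _ (fun z => c0 + c * z i + d * z j)).
- by move=> k x; rewrite !AE !linearD !linearZ (TT i k) (TT j k).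
- move=> z; exists (cmod c + cmod d) => x.
  have -> : A x - (c0 + c * z i + d * z j) *: x =
      c *: (T i x - z i *: x) + d *: (T j x - z j *: x).
    rewrite AE !scalerDl !scalerBr !scalerA !opprD.
    by rewrite [LHS]addrACA; congr (_ + _); rewrite addrACA subrr add0r.
  rewrite (le_trans (nrmD _ _)) // !nrmZ mulrDl.
  by rewrite lerD // ler_wpM2l ?cmod_ge0 ?defect_ge.
- exact: h.
Qed.

End AffineCombination.

(** * Consequences of the inclusion of the Taylor spectrum in the Hartogs triangle *)

Section HartogsContraction.
Variables (R : realType) (H : completeNormedModType R[i]).
Variable ip : {dot H for @Num.conj R[i]}.
Hypothesis hip : hilbert ip.
Variables (n : nat) (T B : 'I_n.+1 -> {linear H -> H}).
Hypothesis bT : forall i, op_bounded (T i).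
Hypothesis TT : forall i j x, T i (T j x) = T j (T i x).
Hypothesis TB : forall i, adjoint_pair ip (T i) (B i).
Hypothesis spT : taylor_spectrum (fun i => T i : H -> H) `<=` @hartogs_triangle R n.

Let bB i : op_bounded (B i).
Proof. exact: op_bounded_adjoint (TB i) (bT i). Qed.

Let BB i j x : B i (B j x) = B j (B i x).
Proof. exact: adjoint_pair_comm (TB i) (TB j) (TT i j) x. Qed.

Let exact_off z : ~ hartogs_triangle z ->
  koszul_exact (fun i => shift_op (T i) (z i) : H -> H).
Proof. by move=> hz; apply: contrapT => /spT. Qed.

Let col_off z : ~ hartogs_triangle z -> exists C, forall x, nrm x <= C * defect T z x.
Proof.
move=> hz; apply: (column_bounded_below hip (exact_off hz)) => [i|i j x|i].
- exact: op_bounded_shift.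
- rewrite !shift_opE !linearB !linearZ /= TT !scalerA.
  by rewrite (mulrC (z i)) addrACA.
- exact: adjoint_pair_shift.
Qed.

(** [B i - z i] is adjoint to [T i] minus the conjugate of [z i], so the conjugate point is the one
    to test. *)
Let row_off (z : 'I_n.+1 -> R[i]) : ~ hartogs_triangle (fun i => Num.conj (z i)) ->
  exists C, forall x, nrm x <= C * defect B z x.
Proof.
move=> hz.
have hadj i : adjoint_pair ip (shift_op (T i) (Num.conj (z i))) (shift_op (B i) (z i)).
  by have := adjoint_pair_shift (Num.conj (z i)) (TB i); rewrite conjCK.
exact: (row_bounded_below hip (exact_off hz) hadj).
Qed.

Lemma hartogs_lt (z : 'I_n.+1 -> R[i]) : hartogs_triangle z ->
  forall j : 'I_n, cmod (z (cur j)) < cmod (z (nxt j)).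
Proof. by move=> [h _] j; have := h j; rewrite !cmodE ltcR. Qed.

Lemma hartogs_lt1 (z : 'I_n.+1 -> R[i]) : hartogs_triangle z -> forall i, cmod (z i) < 1.
Proof.
move=> hz; apply: ord_chain => [|j]; last exact: lt_trans (hartogs_lt hz j).
by have [_] := hz; rewrite cmodE -(rmorph1 (real_complex R)) ltcR.
Qed.

Let bb (c0 c d : R[i]) i j :
  (forall z, hartogs_triangle z -> c0 + c * z i + d * z j != 0) ->
  bounded_below (fun x => c0 *: x + c *: T i x + d *: T j x).
Proof.
move=> h; apply: affine_bounded_below => // z hz; apply: col_off => /h.
by rewrite hz eqxx.
Qed.

Let bb_adj (c0 c d : R[i]) i j :
  (forall z, hartogs_triangle z ->
    Num.conj c0 + Num.conj c * z i + Num.conj d * z j != 0) ->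
  bounded_below (fun x => c0 *: x + c *: B i x + d *: B j x).
Proof.
move=> h; apply: affine_bounded_below => // z hz; apply: row_off => /h.
by rewrite -!rmorphM -!rmorphD hz rmorph0 eqxx.
Qed.

Lemma nxt_invertible (j : 'I_n) : invertible_op (T (nxt j)).
Proof.
have nz (z : 'I_n.+1 -> R[i]) : hartogs_triangle z -> z (nxt j) != 0.
  move=> hz; rewrite -cmod_gt0; apply: le_lt_trans (hartogs_lt hz j).
  exact: cmod_ge0.
apply: (invertible_op_of_bounded_below hip (TB _) (bT _)).
  have [|C hC] := @bb 0 1 0 (nxt j) (nxt j).
    by move=> z /nz; rewrite add0r mul0r addr0 mul1r.
  by exists C => x; have := hC x; rewrite !scale0r add0r addr0 scale1r.
have [|C hC] := @bb_adj 0 1 0 (nxt j) (nxt j).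
  by move=> z /nz; rewrite !rmorph0 rmorph1 add0r mul0r addr0 mul1r.
by exists C => x; have := hC x; rewrite !scale0r add0r addr0 scale1r.
Qed.

Let sub1_neq0 (c : R[i]) : cmod c < 1 -> 1 - c != 0.
Proof.
move=> c1; rewrite subr_eq0; apply/eqP => c1'; move: c1.
by rewrite -c1' -(rmorph1 (real_complex R)) cmod_real // ltxx.
Qed.

(** [1 - z T_i] and [1 - z T_i^*] are bounded below on the closed unit disc, hence on a disc of
    radius [Z > 1], and [r = 1 / Z]. A single [r < 1] is required to keep the supremum strictly
    below [1]. *)
Lemma spectrum_gap i : exists2 r, 0 <= r < 1 & forall l, spectrum (T i) l -> cmod l <= r.
Proof.
have small (z w : R[i]) : cmod z <= 1 -> cmod w < 1 -> cmod (z * w) < 1.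
  move=> z1 w1; rewrite cmodM (le_lt_trans _ w1) // ler_piMl ?cmod_ge0 //.
have unif (S : {linear H -> H}) : op_bounded S ->
    (forall z, cmod z <= 1 -> bounded_below (fun x => x - z *: S x)) ->
    exists2 Z, 1 < Z & exists C, forall z, cmod z <= Z ->
      forall x, nrm x <= C * nrm (x - z *: S x).
  move=> [M M0 hM] h.
  have [||Z Z1 [C C0 hC]] := @uniform_resolvent R H S (fun=> 0) M _ M0 hM 1 ler01 _.
  - by [].
  - move=> z /h[C hC]; exists C => x; rewrite addr0; exact: hC.
  by exists Z => //; exists C => z zZ x; have := hC z zZ x; rewrite addr0.
have [|Z1 Z1gt [C1 h1]] := unif (T i) (bT i).
  move=> z z1; have [|C hC] := @bb 1 (- z) 0 i i.
    move=> w hw; rewrite mul0r addr0 mulNr sub1_neq0 // small //.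
    exact: hartogs_lt1.
  by exists C => x; have := hC x; rewrite scale0r addr0 scale1r scaleNr.
have [|Z2 Z2gt [C2 h2]] := unif (B i) (bB i).
  move=> z z1; have [|C hC] := @bb_adj 1 (- z) 0 i i.
    move=> w hw; rewrite rmorph0 mul0r addr0 rmorph1 rmorphN mulNr sub1_neq0 // small //.
      by rewrite cmod_conj.
    exact: hartogs_lt1.
  by exists C => x; have := hC x; rewrite scale0r addr0 scale1r scaleNr.
have Zgt : 1 < Num.min Z1 Z2 by rewrite lt_min Z1gt.
have Z0 : 0 < Num.min Z1 Z2 by apply: lt_trans Zgt.
exists (Num.min Z1 Z2)^-1; first by rewrite invr_ge0 (ltW Z0) invf_lt1.
move=> l sl; rewrite leNgt; apply/negP => lt_l; apply: sl.
have l0 : 0 < cmod l by apply: lt_trans lt_l; rewrite invr_gt0.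
have cl : cmod l^-1 <= Num.min Z1 Z2.
  by rewrite cmodV -[leRHS]invrK lef_pV2 ?posrE ?invr_gt0 // ltW.
have factor (S : {linear H -> H}) (m : R[i]) C : cmod m = cmod l ->
    (forall x, nrm x <= C * nrm (x - m^-1 *: S x)) -> bounded_below (shift_op S m).
  move=> ml h; exists (C / cmod l) => x; apply: le_trans (h x) _.
  have m0 : m != 0 by rewrite -cmod_gt0 ml.
  rewrite shift_opE -mulrA -ml -cmodV -nrmZ scalerBr scalerA mulVf // scale1r.
  by rewrite nrm_distC.
apply: (invertible_op_of_bounded_below hip (adjoint_pair_shift l (TB i))).
- exact: op_bounded_shift.
- by apply: (factor _ _ C1) => // x; apply: h1; apply: le_trans cl _; rewrite ge_min lexx.
- apply: (factor _ _ C2); rewrite ?cmod_conj // => x; apply: h2.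
  by rewrite cmodV cmod_conj -cmodV (le_trans cl) // ge_min lexx orbT.
Qed.

Lemma spectral_radius_ub i l : spectrum (T i) l -> cmod l <= spectral_radius (T i).
Proof.
move=> sl; have [r _ hr] := spectrum_gap i.
apply: ub_le_sup; last by exists l.
by exists r => _ [m sm <-]; exact: hr.
Qed.

Lemma spectral_radius_ge0 i : 0 <= spectral_radius (T i).
Proof.
have [s0|/set0P[l sl]] := eqVneq (spectrum (T i)) set0.
  by rewrite /spectral_radius s0 image_set0 sup0.
exact: le_trans (cmod_ge0 l) (spectral_radius_ub sl).
Qed.

Lemma spectral_radius_le i r : 0 <= r ->
  (forall l, spectrum (T i) l -> cmod l <= r) -> spectral_radius (T i) <= r.
Proof.
move=> r0 h; rewrite /spectral_radius.
(* The default value [sup set0 = 0] is covered by [0 <= r]. *)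
have [->|/set0P ne] := eqVneq (spectrum (T i)) set0.
  by rewrite image_set0 sup0.
apply: ge_sup; first exact: image_nonempty.
by move=> _ [l sl <-]; exact: h.
Qed.

Lemma spectral_radius_lt1 i : spectral_radius (T i) < 1.
Proof.
have [r /andP[r0 r1] hr] := spectrum_gap i.
exact: le_lt_trans (spectral_radius_le r0 hr) r1.
Qed.

(** Let [cmod l] exceed the radius of [T (nxt j)]. At a point [z] of the triangle with
    [z (cur j) = l], [z (nxt j)] is larger still, so [T (nxt j) - z (nxt j)] is invertible and [z]
    is no approximate joint eigenvalue. Thus [T (cur j) - l] and its adjoint are bounded below. *)
Lemma spectral_radius_cur_nxt (j : 'I_n) :
  spectral_radius (T (cur j)) <= spectral_radius (T (nxt j)).
Proof.
apply: spectral_radius_le => [|l sl]; first exact: spectral_radius_ge0.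
rewrite leNgt; apply/negP => lt_l; apply: sl.
have inv_nxt (z : 'I_n.+1 -> R[i]) : hartogs_triangle z -> z (cur j) = l ->
    invertible_op (shift_op (T (nxt j)) (z (nxt j))).
  move=> hz zl; apply: contrapT => /spectral_radius_ub.
  rewrite leNgt => /negP; apply.
  by apply: lt_trans lt_l _; rewrite -zl; exact: hartogs_lt.
have via (S : 'I_n.+1 -> {linear H -> H}) (z : 'I_n.+1 -> R[i]) :
    bounded_below (shift_op (S (nxt j)) (z (nxt j))) ->
    exists C, forall x, nrm x <= C * defect S z x.
  move=> /bounded_below_pos[C C0 hC]; exists C => x; apply: le_trans (hC x) _.
  by rewrite ler_wpM2l ?(ltW C0) // defect_ge.
apply: (invertible_op_of_bounded_below hip (adjoint_pair_shift l (TB (cur j)))).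
- exact: op_bounded_shift.
- have [|C hC] := @affine_bounded_below _ _ _ T bT TT (- l) 1 0 (cur j) (cur j).
    move=> z; rewrite mul0r addr0 mul1r addrC => /eqP; rewrite subr_eq0 => /eqP zl.
    have [hz|] := pselect (hartogs_triangle z); last exact: col_off.
    by apply: via; apply: invertible_op_bounded_below; exact: inv_nxt.
  by exists C => x; have := hC x; rewrite scale0r addr0 scale1r scaleNr addrC.
- have [|C hC] := @affine_bounded_below _ _ _ B bB BB (- Num.conj l) 1 0 (cur j) (cur j).
    move=> z; rewrite mul0r addr0 mul1r addrC => /eqP; rewrite subr_eq0 => /eqP zl.
    have [hz|] := pselect (hartogs_triangle (fun i => Num.conj (z i)));
      last exact: row_off.
    apply: via; have -> : z (nxt j) = Num.conj (Num.conj (z (nxt j))) by rewrite conjCK.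
    apply: (invertible_op_bounded_below_adjoint hip (adjoint_pair_shift _ (TB _))).
    by apply: (inv_nxt _ hz); rewrite zl conjCK.
  by exists C => x; have := hC x; rewrite scale0r addr0 scale1r scaleNr addrC.
Qed.

Let X (i : 'I_n.+1) := mpoly.mpolyX R[i] (mpoly.mnm1 i).
Let form P x := hereditary_form T P x.

Lemma hereditary_form_last P : (forall x, 0 <= form ((1 - X ord_max) * P) x) ->
  forall x, 0 <= form P x.
Proof.
have [K K0 hK] := hereditary_form_bounded bT P.
move=> h; have bid := op_bounded_id H.
apply: (@stein_positivity _ _ (T ord_max) idfun _ K (bT _) bid) => //.
- exists idfun; split=> //; apply/op_boundedP; exact: op_bounded_id.
- move=> z z1; have [|C hC] := @bb 1 (- z) 0 ord_max ord_max.
    move=> w hw; rewrite mul0r addr0 mulNr sub1_neq0 // cmodM.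
    by rewrite (le_lt_trans _ (hartogs_lt1 hw ord_max)) // ler_piMl ?cmod_ge0.
  by exists C => x; have := hC x; rewrite scale0r addr0.
- move=> x; have := h x; rewrite /form mulrBl mul1r mulrC.
  by rewrite hereditary_formB hereditary_formMX // subr_ge0.
Qed.

Lemma hereditary_form_factor (j : 'I_n) P :
  (forall x, 0 <= form ((X (nxt j) - X (cur j)) * P) x) -> forall x, 0 <= form P x.
Proof.
have [K K0 hK] := hereditary_form_bounded bT P.
move=> h; apply: (@stein_positivity _ _ (T (cur j)) (T (nxt j)) _ K) => //.
- exact: nxt_invertible.
- move=> z z1; have [|C hC] := @bb 0 1 (- z) (nxt j) (cur j).
    move=> w hw; rewrite add0r mul1r mulNr subr_eq0; apply/eqP => e.
    have := hartogs_lt hw j; rewrite e cmodM ltNge ler_piMl ?cmod_ge0 //.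
  by exists C => x; have := hC x; rewrite scale0r add0r.
- move=> x; have := h x; rewrite /form mulrC mulrBr.
  by rewrite hereditary_formB !hereditary_formMX // subr_ge0.
Qed.

(** The predicate [p] selects the factors to strip: all of them, or all but the one kept in the
    conclusion. *)
Lemma hereditary_form_factors (s : seq 'I_n) (p : pred 'I_n) P :
  (forall x, 0 <= form (\prod_(j <- s | p j) (X (nxt j) - X (cur j)) * P) x) ->
  forall x, 0 <= form P x.
Proof.
elim: s P => [|j s IH] P; first by rewrite big_nil mul1r.
rewrite big_cons; case: (p j); last exact: IH.
by rewrite -mulrA => /hereditary_form_factor; exact: IH.
Qed.

Hypothesis pos : psd ip (hartogs_op ip (fun i => T i : H -> H)).

Lemma hartogs_form_ge0 x : 0 <= form (hartogs_poly R n) x.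
Proof.
have := pos x; rewrite lecE => /andP[_]; rewrite /hartogs_op ip_suml.
rewrite /form /hereditary_form; congr (_ <= _).
elim/big_rec2: _ => [//|m a b _ <-]; rewrite raddfD; congr (_ + _).
(* [oppow] is a bare function; it is bundled as a linear [A] so that [adjoint_pairP] applies. *)
have [A hA] := linear_pack (@oppow_linear _ _ _ T m).
have [M M0 hM] := oppow_bounded bT m.
have [|A' [AA' A'E]] := adjoint_pairP hip (A := A).
  by exists M => // y; rewrite hA.
have fA : (A : H -> H) = oppow (fun i => T i : H -> H) m by apply/funext => y; exact: hA.
rewrite -fA -A'E ipZl (adjoint_pairC AA') (ip_nrm hip).
by case: (mpoly.mcoeff _ _) => c d /=; rewrite mulr0 subr0.
Qed.

Lemma form_X i x : form (1 * X i) x = nrm (T i x) ^+ 2.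
Proof. by rewrite /form hereditary_formMX // hereditary_form1. Qed.

(** Stripping [1 - X ord_max] and every difference except the one at [j] leaves the form of
    [X (nxt j) - X (cur j)]. *)
Lemma nrm_cur_nxt (j : 'I_n) x : nrm (T (cur j) x) ^+ 2 <= nrm (T (nxt j) x) ^+ 2.
Proof.
rewrite -subr_ge0 -!form_X -hereditary_formB !mul1r.
move: x; apply: (@hereditary_form_factors (index_enum _) (predC1 j)).
apply: hereditary_form_last => x.
have := hartogs_form_ge0 x; rewrite /hartogs_poly (bigD1 j) //=.
by rewrite [_ * \prod_(i | _) _]mulrC.
Qed.

(** Stripping all the differences leaves [1 - X ord_max], the claim for the last operator;
    [nrm_cur_nxt] carries it down the chain. *)
Lemma nrm_le1 i x : nrm (T i x) ^+ 2 <= nrm x ^+ 2.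
Proof.
move: i x; apply: ord_chain => [x|j IH x]; last exact: le_trans (nrm_cur_nxt j x) (IH x).
rewrite -subr_ge0 -form_X -(hereditary_form1 T) -hereditary_formB mul1r.
move: x; apply: (@hereditary_form_factors (index_enum _) xpredT) => x.
by rewrite mulrC; exact: hartogs_form_ge0.
Qed.

Lemma ople_adjoint (A D : {linear H -> H}) : op_bounded A -> op_bounded D ->
  (forall x, nrm (A x) ^+ 2 <= nrm (D x) ^+ 2) ->
  ople ip (adjoint ip A \o A) (adjoint ip D \o D).
Proof.
move=> /(adjoint_pairP hip)[A' [AA' A'E]] /(adjoint_pairP hip)[D' [DD' D'E]] h x.
rewrite /= -A'E -D'E ipBl (adjoint_pairC AA') (adjoint_pairC DD').
by rewrite !(ip_nrm hip) -rmorphB ler0c subr_ge0.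
Qed.

End HartogsContraction.

Theorem corollary7p9 (R : realType) (H : completeNormedModType R[i])
    (ip : {dot H for @Num.conj R[i]}) (n : nat)
    (T : 'I_n.+1 -> {linear H -> H}) :
  hilbert ip ->
  (2 <= n.+1)%N ->
  hartogs_contraction ip T ->
  taylor_spectrum T `<=` @hartogs_triangle R n ->
  [/\ forall j : 'I_n, invertible_op (T (nxt j)),
      forall j : 'I_n,
        ople ip (adjoint ip (T (cur j)) \o T (cur j))
                (adjoint ip (T (nxt j)) \o T (nxt j)) /\
        ople ip (adjoint ip (T (nxt j)) \o T (nxt j)) id
    & forall j : 'I_n,
        spectral_radius (T (cur j)) <= spectral_radius (T (nxt j)) < 1].
Proof.
move=> hip _ [bnd TT pos] spT.
have bT i : op_bounded (T i) by apply/op_boundedP.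
have [B hB] := choice (fun i => adjoint_pairP hip (bT i)).
have TB i : adjoint_pair ip (T i) (B i) by have [] := hB i.
split=> [j|j|j].
- exact: (nxt_invertible hip bT TT TB spT).
- split; first by apply: ople_adjoint => // x; exact: (nrm_cur_nxt hip bT TT TB spT pos).
  move=> x; rewrite /= ipBl -(proj2 (hB (nxt j))) (adjoint_pairC (TB _)).
  rewrite !(ip_nrm hip) -rmorphB ler0c subr_ge0.
  exact: (nrm_le1 hip bT TT TB spT pos).
- rewrite (spectral_radius_cur_nxt hip bT TT TB spT).
  exact: (spectral_radius_lt1 hip bT TT TB spT).
Qed.
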